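(* Let $R\subseteq S$ be a ring extension. The following are equivalent: (i) $R\subseteq S$ is quasi-Prüfer; (ii) $R\subseteq T$ is quasi-finite for each $T\in[R,S]$ which is of finite type over $R$; (iii) $R\subseteq T$ has finite fibers for each $T\in[R,S]$ which is of finite type over $R$; (iv) for each $T\in[R,S]$, all fiber morphisms $\kappa(P)\to\kappa(P)\otimes_R T$ ($P\in\mathrm{Spec}(R)$) are integral.
   Context: All rings are commutative with identity. $[R,S]$ is the set of $R$-subalgebras of $S$; $\kappa(P)=R_P/PR_P$. A ring morphism $R\to T$ is quasi-finite if it is of finite type and $\kappa(P)\otimes_R T$ is a finite-dimensional $\kappa(P)$-vector space for each $P\in\mathrm{Spec}(R)$. $R\subseteq T$ has finite fibers if for each $P\in\mathrm{Spec}(R)$ the set $\{Q\in\mathrm{Spec}(T)\mid Q\cap R=P\}$ is finite. $A\subseteq B$ is Prüfer if $A\subseteq U$ is a flat epimorphism (flat and an epimorphism of commutative rings) for every $U\in[A,B]$; $R\subseteq S$ is quasi-Prüfer if $\overline R\subseteq S$ is Prüfer, where $\overline R$ is the integral closure of $R$ in $S$. *)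

(* Defs.v *)
From HB Require Import structures.
From mathcomp Require Import all_boot all_order all_algebra.
From mathcomp Require Import classical_sets cardinality.
Set Implicit Arguments. Unset Strict Implicit. Unset Printing Implicit Defensive.
Import GRing.Theory.
Local Open Scope ring_scope.

(* Throughout, S is an ambient commutative ring (possibly zero) and all the
   rings R ⊆ T ⊆ S are subrings of S, given as predicates on S. *)
Section Defs.
Variable S : comPzRingType.

Definition subring (A : set S) : Prop :=
  A 1 /\ (forall x y, A x -> A y -> A (x - y)) /\
  (forall x y, A x -> A y -> A (x * y)).

Definition included (A B : set S) : Prop := forall x, A x -> B x.

Definition interm (A B T : set S) : Prop :=
  subring T /\ included A T /\ included T B.

Definition gen_alg (A : set S) (xs : seq S) : set S :=
  fun x => forall U, subring U -> included A U ->
                     (forall y, y \in xs -> U y) -> U x.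

Definition finite_type (A T : set S) : Prop :=
  exists xs : seq S, forall x, T x <-> gen_alg A xs x.

Definition int_closure (A B : set S) : set S :=
  fun x => B x /\ exists (n : nat) (c : nat -> S),
    (forall i, A (c i)) /\ x ^+ n + \sum_(i < n) c i * x ^+ i = 0.

Definition prime_of (A P : set S) : Prop :=
  included P A /\ P 0 /\ (forall x y, P x -> P y -> P (x - y)) /\
  (forall a x, A a -> P x -> P (a * x)) /\ ~ P 1 /\
  (forall x y, A x -> A y -> P (x * y) -> P x \/ P y).

Definition ext_ideal (P T : set S) : set S :=
  fun x => exists (n : nat) (p t : nat -> S),
    (forall i, P (p i) /\ T (t i)) /\ x = \sum_(i < n) p i * t i.

(* The fiber ring κ(P) ⊗_A T = T_P / P T_P (localization at A \ P).
   Its κ(P)-dimension is finite iff finitely many t_1..t_n ∈ T span it,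
   i.e. (clearing denominators) every t ∈ T satisfies
   s t - Σ r_i t_i ∈ P T for some s ∈ A \ P and r_i ∈ A. *)
Definition fiber_finite_dim (A T P : set S) : Prop :=
  exists (n : nat) (g : nat -> S), (forall i, T (g i)) /\
    forall t, T t -> exists (s : S) (r : nat -> S),
      A s /\ ~ P s /\ (forall i, A (r i)) /\
      ext_ideal P T (s * t - \sum_(i < n) r i * g i).

(* The fiber morphism κ(P) -> κ(P) ⊗_A T is integral: every element (class of
   t/1, t ∈ T) is a root of a monic polynomial over κ(P), i.e. (clearing
   denominators) s t^n + Σ_{i<n} r_i t^i ∈ P T with s ∈ A \ P, r_i ∈ A. *)
Definition fiber_integral (A T P : set S) : Prop :=
  forall t, T t -> exists (n : nat) (s : S) (r : nat -> S),
    A s /\ ~ P s /\ (forall i, A (r i)) /\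
    ext_ideal P T (s * t ^+ n + \sum_(i < n) r i * t ^+ i).

Definition quasi_finite (A T : set S) : Prop :=
  finite_type A T /\ forall P, prime_of A P -> fiber_finite_dim A T P.

Definition finite_fibers (A T : set S) : Prop :=
  forall P, prime_of A P ->
    finite_set [set Q : set S | prime_of T Q /\
                                (forall x, A x -> (Q x <-> P x))].

(* A ⊆ U is an epimorphism of commutative rings: ring morphisms U -> C
   (represented as maps S -> C that are ring morphisms on U) agreeing on A
   agree on U. *)
Definition rmorph_on (U : set S) (C : comPzRingType) (f : S -> C) : Prop :=
  f 1 = 1 /\ (forall x y, U x -> U y -> f (x + y) = f x + f y) /\
  (forall x y, U x -> U y -> f (x * y) = f x * f y).

Definition epimorphism (A U : set S) : Prop :=
  forall (C : comPzRingType) (f g : S -> C),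
    rmorph_on U f -> rmorph_on U g -> (forall a, A a -> f a = g a) ->
    forall u, U u -> f u = g u.

(* U is a flat A-module (equational criterion of flatness: every linear
   relation in U with coefficients in A is a consequence of relations in A). *)
Definition flat (A U : set S) : Prop :=
  forall (n : nat) (a x : nat -> S), (forall i, A (a i)) -> (forall i, U (x i)) ->
    \sum_(i < n) a i * x i = 0 ->
    exists (m : nat) (b : nat -> nat -> S) (y : nat -> S),
      (forall i j, A (b i j)) /\ (forall j, U (y j)) /\
      (forall i, (i < n)%N -> x i = \sum_(j < m) b i j * y j) /\
      (forall j, (j < m)%N -> \sum_(i < n) a i * b i j = 0).

Definition flat_epi (A U : set S) : Prop := flat A U /\ epimorphism A U.

Definition Prufer (A B : set S) : Prop :=
  forall U, interm A B U -> flat_epi A U.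

Definition quasi_Prufer (R B : set S) : Prop :=
  Prufer (int_closure R B) B.

End Defs.

(* Main.v *)
(* The key property is (H): for every [x] in [S] and every prime [P] of [R], [x] is a
   root of a polynomial over [R] having a coefficient outside [P], i.e. the fiber of
   [R[x]] at [P] is not a polynomial ring.  Each of (i)-(iv) is equivalent to (H).

   If (H) fails for [x] and [P], then [R[x]] maps onto the polynomial ring
   [(R/P)[X]].  That ring has infinitely many primes over [0] (Euclid), contradicting
   (iii), and its variable is not integral over [R/P], contradicting (iv).

   For (i) => (H), let [A] be the integral closure of [R] in [S].  The failure of (H)
   over [A] contradicts that [A -> A[x]] is an epimorphism: the surjection
   [A[x] -> (A/P)[X]] and its composite with [X |-> 0] agree on [A] but not at [x].
   The property descends from [A] to [R]: if the fiber of [R[x]] at [P] is a polynomial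
   ring, then some prime [Q] of the integral closure of [R[x]] contracts to the
   transcendental prime [P R[x]], while modulo [Q] the element [x] is algebraic over
   [A], hence over [R].

   (H) makes the fibers of [R[x_1, ..., x_n]] finite-dimensional, and these then have
   finitely many primes, since pairwise incomparable primes produce linearly
   independent elements.

   For (H) => (i), Horner's scheme applied to [c_n x^n + ... + c_0 = 0] shows that all
   the coefficients lie in [(A : x) + (A : x) x].  By (H) this contains [1], so that
   [1 = p + q x] with [p, q, p x, q x] in [A]; every intermediate ring is then a flat
   epimorphic extension of [A]. *)
From HB Require Import structures.
Require Import Defs.
From mathcomp Require Import all_boot all_order all_algebra.
From mathcomp Require Import perm generic_quotient ring_quotient.
From mathcomp Require Import boolp classical_sets cardinality finmap.

Set Implicit Arguments.
Unset Strict Implicit.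
Unset Printing Implicit Defensive.

Import GRing.Theory.
Local Open Scope classical_set_scope.
Local Open Scope quotient_scope.
Local Open Scope ring_scope.

(** * Subrings, ideals and primes given as predicates *)

Section Basics.
Variable S : comPzRingType.
Implicit Types (A B I M P Q G V : set S).

Definition subgroup G := G 0 /\ forall x y, G x -> G y -> G (x - y).

Definition ideal_of A I :=
  included I A /\ subgroup I /\ forall a x, A a -> I x -> I (a * x).

Lemma subgroupN G : subgroup G -> forall x, G x -> G (- x).
Proof. by move=> [G0 GB] x Gx; rewrite -sub0r; apply: (GB). Qed.

Lemma subgroupD G : subgroup G -> forall x y, G x -> G y -> G (x + y).
Proof. by move=> hG x y Gx Gy; rewrite -[y]opprK; apply: hG.2 => //; apply: subgroupN. Qed.

Lemma subgroup_sum G : subgroup G -> forall (T : Type) (r : seq T) (p : pred T) (F : T -> S),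
  (forall i, p i -> G (F i)) -> G (\sum_(i <- r | p i) F i).
Proof. by move=> hG T r p F hF; elim/big_ind: _ => //; [case: hG | apply: subgroupD]. Qed.

Lemma subgroup0 : subgroup (fun x : S => x = 0).
Proof. by split=> // x y -> ->; rewrite subr0. Qed.

Lemma subring_subgroup A : subring A -> subgroup A.
Proof. by move=> [A1 [AB _]]; split=> //; rewrite -(subrr 1); apply: (AB). Qed.

Lemma subring_prod A : subring A -> forall (T : Type) (r : seq T) (p : pred T) (F : T -> S),
  (forall i, p i -> A (F i)) -> A (\prod_(i <- r | p i) F i).
Proof. by move=> [A1 [_ AM]] T r p F hF; elim/big_ind: _ => //. Qed.

Lemma subringX A : subring A -> forall x n, A x -> A (x ^+ n).
Proof.
by move=> [A1 [_ AM]] x n Ax; elim: n => [|n IH]; rewrite ?expr0 // exprS; apply: (AM).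
Qed.

Lemma subringT : subring [set: S].
Proof. by []. Qed.

Lemma subring_ideal A : subring A -> ideal_of A A.
Proof. by move=> hA; split=> //; split; [apply: subring_subgroup | case: hA => _ []]. Qed.

Lemma ideal_of0 A : subring A -> ideal_of A (fun x => x = 0).
Proof.
move=> hA; split; first by move=> x ->; case: (subring_subgroup hA).
by split; [apply: subgroup0 | move=> a x _ ->; rewrite mulr0].
Qed.

Lemma prime_ideal A P : prime_of A P -> ideal_of A P.
Proof. by move=> [hs [h0 [hB [hM _]]]]. Qed.

Lemma gen_alg_subring A xs : subring (gen_alg A xs).
Proof.
split; first by move=> U [U1 _].
split=> x y hx hy U hU hA hxs; have [_ [UB UM]] := hU.
  by apply: UB; [apply: hx | apply: hy].
by apply: UM; [apply: hx | apply: hy].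
Qed.

Lemma gen_alg_base A xs : included A (gen_alg A xs).
Proof. by move=> x Ax U _ hA _; apply: hA. Qed.

Lemma gen_alg_mem A xs x : x \in xs -> gen_alg A xs x.
Proof. by move=> hx U _ _; apply. Qed.

Lemma gen_alg_interm A xs : interm A setT (gen_alg A xs).
Proof. by split; [apply: gen_alg_subring | split=> //; apply: gen_alg_base]. Qed.

Lemma ext_ideal_ideal A P T : subring T -> included A T -> ideal_of A P ->
  ideal_of T (ext_ideal P T).
Proof.
move=> hT AT [PA [hP PM]]; have [T1 [TB TM]] := hT; have gT := subring_subgroup hT.
split; last split; last 1 first.
- move=> a _ Ta [n [p [t [pt ->]]]]; exists n, p, (fun i => a * t i); split.
    by move=> i; have [] := pt i; split=> //; apply: TM.
  by rewrite mulr_sumr; apply: eq_bigr => i _; rewrite mulrCA.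
- move=> _ [n [p [t [pt ->]]]]; apply: subgroup_sum => // i _.
  by have [/PA/AT ? ?] := pt i; apply: TM.
split.
  exists 0%N, (fun=> 0), (fun=> 0); rewrite big_ord0; split=> // i.
  by split; [case: hP | case: gT].
move=> _ _ [n [p [t [pt ->]]]] [m [q [u [qu ->]]]].
exists (n + m)%N, (fun i => if (i < n)%N then p i else - q (i - n)%N),
  (fun i => if (i < n)%N then t i else u (i - n)%N); split.
  move=> i; case: ifP => _; first exact: pt.
  by have [] := qu (i - n)%N; split=> //; apply: subgroupN.
rewrite big_split_ord /= -sumrN; congr (_ + _); apply: eq_bigr => i _.
  by rewrite ltn_ord.
by rewrite ltnNge leq_addr /= addKn mulNr.
Qed.

Lemma ext_idealM P T p t : P p -> T t -> ext_ideal P T (p * t).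
Proof. by move=> Pp Tt; exists 1%N, (fun=> p), (fun=> t); rewrite big_ord1. Qed.

Lemma ext_ideal_sub P T Q : included P Q -> ideal_of T Q -> included (ext_ideal P T) Q.
Proof.
move=> PQ [_ [gQ QM]] _ [n [p [t [pt ->]]]]; apply: subgroup_sum => // i _.
by have [/PQ ? ?] := pt i; rewrite mulrC; apply: QM.
Qed.

Lemma prime_contraction A B Q : subring A -> included A B -> prime_of B Q ->
  prime_of A (fun x => A x /\ Q x).
Proof.
move=> hA AB [QB [Q0 [QD [QM [Q1 Qp]]]]]; have [A1 [AS AM]] := hA.
split; first by move=> x [].
split; first by split=> //; case: (subring_subgroup hA).
split; first by move=> x y [? ?] [? ?]; split; [apply: AS | apply: QD].
split; first by move=> a x Aa [? ?]; split; [apply: AM | apply: QM => //; apply: AB].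
split; first by case.
by move=> x y Ax Ay [_ /(Qp _ _ (AB _ Ax) (AB _ Ay))[]]; [left|right].
Qed.

Lemma exists_prime_disjoint A I M : subring A -> ideal_of A I -> included M A ->
  M 1 -> (forall x y, M x -> M y -> M (x * y)) -> (forall x, I x -> ~ M x) ->
  exists Q, [/\ prime_of A Q, included I Q & forall x, Q x -> ~ M x].
Proof.
move=> hA hI MA M1 MM IM; have [A1 [AB AM]] := hA.
have gA := subring_subgroup hA.
pose good X := ideal_of A X /\ forall x, X x -> ~ M x.
(* The empty chain forces the detour through [X `|` I]. *)
have [|Q [gQ maxQ]] := @Zorn_bigcup _ (fun X : set S => good (X `|` I)).
  move=> F hF tot.
  have two x y : ((\bigcup_(X in F) X) `|` I) x -> ((\bigcup_(X in F) X) `|` I) y ->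
      (I x /\ I y) \/ exists2 X, F X & (X `|` I) x /\ (X `|` I) y.
    move=> [[X FX Xx]|Ix] [[Y FY Yy]|Iy].
    - case: (tot _ _ FX FY) => h; right.
        by exists Y => //; split; left => //; apply: h.
      by exists X => //; split; left => //; apply: h.
    - by right; exists X => //; split; [left|right].
    - by right; exists Y => //; split; [right|left].
    - by left.
  have sub X : F X -> (X `|` I) `<=` ((\bigcup_(X in F) X) `|` I).
    by move=> FX x [Xx|]; [left; exists X | right].
  have [IA [[I0 IB] IM']] := hI.
  split; first split.
  - by move=> x hx; case: (two x x hx hx) => [[/IA]//|[X FX [Xx _]]];
       have [[/(_ x Xx)]] := hF _ FX.
  - split; first split; first by right.
    + move=> x y hx hy; case: (two x y hx hy) => [[Ix Iy]|[X FX [Xx Xy]]].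
        by right; apply: IB.
      by apply: (sub _ FX); have [[_ [[_ XB] _]] _] := hF _ FX; apply: XB.
    + move=> a x Aa hx; case: (two x x hx hx) => [[Ix _]|[X FX [Xx _]]].
        by right; apply: IM'.
      by apply: (sub _ FX); have [[_ [_ XM]] _] := hF _ FX; apply: XM.
  - move=> x hx; case: (two x x hx hx) => [[/IM]//|[X FX [Xx _]]].
    by have [_ /(_ x Xx)] := hF _ FX.
have [[QA [[Q0 QB] QM]] QnM] := gQ; set J := Q `|` I in Q0 QB QM QnM gQ QA.
have gJ : subgroup J by [].
have meet x : A x -> ~ J x -> exists q a, [/\ J q, A a & M (q + a * x)].
  move=> Ax Jx; apply: contrapT => hno.
  pose K := fun y => exists q a, [/\ J q, A a & y = q + a * x].
  have JK : included J K.
    by move=> y Jy; exists y, 0; rewrite mul0r addr0; split=> //; case: gA.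
  apply: (maxQ K).
    split; first by move=> y Qy; apply: JK; left.
    move=> KQ; apply: Jx; left; apply: KQ; exists 0, 1; split=> //.
    by rewrite add0r mul1r.
  have -> : K `|` I = K.
    by apply/seteqP; split=> [y [//|Iy]|y Ky]; [apply: JK; right | left].
  split; last first.
    by move=> _ [q [a [Jq Aa ->]]] Mq; apply: hno; exists q, a.
  split; first by move=> _ [q [a [Jq Aa ->]]]; apply: subgroupD => //; [apply: QA | apply: AM].
  split; first split; first exact: JK.
    move=> _ _ [q [a [Jq Aa ->]]] [q' [a' [Jq' Aa' ->]]]; exists (q - q'), (a - a').
    by split; [apply: QB|apply: AB| rewrite mulrBl opprD addrACA].
  move=> b _ Ab [q [a [Jq Aa ->]]]; exists (b * q), (b * a).
  by split; [apply: QM|apply: AM| rewrite mulrDr mulrA].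
exists J; split=> //; last by move=> x Ix; right.
split=> //; split=> //; split=> //; split=> //; split; first by move=> /QnM.
move=> x y Ax Ay Jxy; apply: contrapT => /not_orP[Jx Jy].
have [q [a [Jq Aa Mx]]] := meet _ Ax Jx; have [q' [a' [Jq' Aa' My]]] := meet _ Ay Jy.
apply: QnM (MM _ _ Mx My).
rewrite mulrDl; apply: subgroupD => //.
  rewrite mulrC; apply: QM => //; apply: subgroupD => //; [exact: QA | exact: AM].
rewrite mulrDr; apply: subgroupD => //; first by apply: QM => //; apply: AM.
by rewrite mulrACA; apply: QM => //; apply: AM.
Qed.

Lemma exists_prime_above A I : subring A -> ideal_of A I -> ~ I 1 ->
  exists2 Q, prime_of A Q & included I Q.
Proof.
move=> hA hI I1.
have [||||Q [? ? _]] := @exists_prime_disjoint A I (fun x => x = 1) hA hI; last by exists Q.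
- by move=> x ->; case: hA.
- by [].
- by move=> x y -> ->; rewrite mulr1.
- by move=> x Ix x1; apply: I1; rewrite -x1.
Qed.

End Basics.

(** * The quotient domain A/P *)

Section DomainUnit.
Variables (D : comNzRingType).
Definition classical_unit : pred D := fun x => `[< exists y, y * x = 1 >].
Definition classical_inv (x : D) : D :=
  if pselect (exists y, y * x = 1) is left h then sval (cid h) else x.
Lemma classical_mulVr : {in classical_unit, left_inverse 1 classical_inv *%R}.
Proof.
move=> x /asboolP h; rewrite /classical_inv; case: pselect => // h'.
by case: (cid h').
Qed.
Lemma classical_unitP x y : y * x = 1 -> classical_unit x.
Proof. by move=> h; apply/asboolP; exists y. Qed.
Lemma classical_inv_out : {in [predC classical_unit], classical_inv =1 id}.
Proof.
by move=> x /asboolPn h; rewrite /classical_inv; case: pselect.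
Qed.
End DomainUnit.

Section SubringType.
Variables (S : comNzRingType) (A : set S).

Definition subring_pred & subring A : {pred S} := fun x => `[< A x >].
Hypothesis hA : subring A.

Lemma subring_pred_closed : subring_closed (subring_pred hA).
Proof.
case: (hA) => [h1 [hB hM]]; split; first exact/asboolP.
  by move=> x y /asboolP hx /asboolP hy; apply/asboolP; exact: hB.
by move=> x y /asboolP hx /asboolP hy; apply/asboolP; exact: hM.
Qed.
HB.instance Definition _ := GRing.isSubringClosed.Build S (subring_pred hA) subring_pred_closed.

Definition subring_type := {x : S | subring_pred hA x}.
HB.instance Definition _ := SubChoice.on subring_type.
HB.instance Definition _ := [SubChoice_isSubComNzRing of subring_type by <:].
End SubringType.

Section QuotientDomain.
Variables (S : comNzRingType) (A P : set S) (hA : subring A) (hP : prime_of A P).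
Local Notation AT := (subring_type hA).
Definition prime_pred & prime_of A P : {pred AT} := fun x => `[< P (val x) >].
Lemma prime_pred_ideal : idealr_closed (prime_pred hP).
Proof.
have [_ [h0 [hB [hM [h1 _]]]]] := hP; split; first exact/asboolP.
  by apply/asboolP.
move=> a x y /asboolP hx /asboolP hy; apply/asboolP.
rewrite /= -[val y]opprK; apply: (hB); last by rewrite -[- _]add0r; apply: (hB).
apply: hM => //; exact/asboolP/(valP a).
Qed.
Lemma prime_pred_prime : prime_idealr_closed (prime_pred hP).
Proof.
have [_ [h0 [hB [hM [h1 hp]]]]] := hP; move=> x y /asboolP h.
by case: (hp _ _ (asboolW (valP x)) (asboolW (valP y)) h) => h';
  apply/orP; [left|right]; exact/asboolP.
Qed.
HB.instance Definition _ := isIdealr.Build AT (prime_pred hP) prime_pred_ideal.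
HB.instance Definition _ := isPrimeIdealrClosed.Build AT (prime_pred hP) prime_pred_prime.

Lemma quotient_domain : exists (D : idomainType) (pi : {rmorphism AT -> D}),
  forall a : AT, pi a = 0 <-> P (val a).
Proof.
pose D := {ideal_quot (prime_pred hP)}.
pose D1 := HB.pack_for comUnitRingType D
  (@GRing.ComNzRing_hasMulInverse.Build D _ _
    (@classical_mulVr D) (@classical_unitP D) (@classical_inv_out D)).
pose D2 := HB.pack_for idomainType D1
  (GRing.ComUnitRing_isIntegral.Build D1 (@Quotient.rquot_IdomainAxiom _ (prime_pred hP))).
pose pi : AT -> D2 := \pi_({ideal_quot (prime_pred hP)}).
have piB : zmod_morphism pi by move=> x y; exact: (rmorphB \pi_({ideal_quot (prime_pred hP)})).
have piM : monoid_morphism pi.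
  by split=> [|x y]; [exact: (rmorph1 \pi_({ideal_quot (prime_pred hP)}))
                    |exact: (rmorphM \pi_({ideal_quot (prime_pred hP)}))].
pose piR : {rmorphism AT -> D2} := HB.pack pi
  (GRing.isZmodMorphism.Build AT D2 pi piB) (GRing.isMonoidMorphism.Build AT D2 pi piM).
exists D2, piR => a; split.
  move=> h; have : a - 0 \in prime_pred hP.
    by rewrite Quotient.idealrBE; apply/eqP; rewrite [LHS]h; exact/esym/(rmorph0 piR).
  by rewrite subr0 => /asboolP.
move=> h; have : a - 0 \in prime_pred hP by rewrite subr0; apply/asboolP.
rewrite Quotient.idealrBE => /eqP h'; apply: etrans h' _; exact: (rmorph0 piR).
Qed.

(* The class of [x] is a variable in the fiber of [A[x]] at [P]. *)
Definition transcendental_mod x := forall n (c : nat -> S), (forall i, A (c i)) ->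
  \sum_(i < n) c i * x ^+ i = 0 -> forall i, (i < n)%N -> P (c i).


Definition incl : {rmorphism AT -> S} := val.
Definition eval_at x (p : {poly AT}) := (map_poly incl p).[x].

Lemma eval_atD x : {morph eval_at x : p q / p + q}.
Proof. by move=> p q; rewrite /eval_at rmorphD hornerD. Qed.
Lemma eval_atB x : {morph eval_at x : p q / p - q}.
Proof. by move=> p q; rewrite /eval_at rmorphB hornerD hornerN. Qed.
Lemma eval_atM x : {morph eval_at x : p q / p * q}.
Proof. by move=> p q; rewrite /eval_at rmorphM hornerM. Qed.
Lemma eval_atC x a : eval_at x a%:P = val a.
Proof. by rewrite /eval_at map_polyC hornerC. Qed.
Lemma eval_atX x : eval_at x 'X = x.
Proof. by rewrite /eval_at map_polyX hornerX. Qed.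

Lemma subring_val (a : AT) : A (val a).
Proof. exact: asboolW (valP a). Qed.

Lemma subring_lift a : A a -> exists a' : AT, a = val a'.
Proof. by move=> /asboolP ha; exists (Sub a ha); rewrite SubK. Qed.

Lemma gen_alg1P x y : gen_alg A [:: x] y <-> exists p : {poly AT}, y = eval_at x p.
Proof.
split.
  move=> h; apply: (h (fun y => exists p : {poly AT}, y = eval_at x p)); first split.
  - by exists 1%:P; rewrite eval_atC rmorph1.
  - split.
    + by move=> _ _ [p ->] [q ->]; exists (p - q); rewrite eval_atB.
    + by move=> _ _ [p ->] [q ->]; exists (p * q); rewrite eval_atM.
  - by move=> _ /subring_lift[a ->]; exists a%:P; rewrite eval_atC.
  - by move=> z; rewrite inE => /eqP ->; exists 'X; rewrite eval_atX.
move=> [p ->] U hU hAU hx; have {}hx : U x by apply: hx; rewrite inE.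
have [U1 [UB UM]] := hU.
have U0 : U 0 by rewrite -(subrr 1); apply: (UB).
have UD a b : U a -> U b -> U (a + b).
  by move=> ha hb; rewrite -[b]opprK; apply: (UB) => //; rewrite -[- b]add0r; apply: (UB).
elim/poly_ind: p => [|p c IH]; first by rewrite /eval_at rmorph0 horner0.
rewrite eval_atD eval_atM eval_atX eval_atC; apply: UD; first exact: UM.
exact/hAU/subring_val.
Qed.

Lemma transcendental_quotient x : transcendental_mod x ->
  exists (D : idomainType) (ps : S -> D) (phi : S -> {poly D}),
  [/\ rmorph_on (gen_alg A [:: x]) phi, phi x = 'X
    & forall a, A a -> phi a = (ps a)%:P /\ (ps a = 0 <-> P a)].
Proof.
move=> tx; have [D [pi piP]] := quotient_domain.
have ker (p : {poly AT}) : eval_at x p = 0 -> map_poly pi p = 0.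
  move=> p0; apply/polyP => i; rewrite coef_map coef0; apply/piP.
  case: (ltnP i (size p)) => hi; last first.
    by rewrite nth_default //=; have [_ []] := hP.
  apply: (tx (size p) (fun i => val p`_i)) => [j||//]; first exact: subring_val.
  rewrite -[RHS]p0 /eval_at horner_coef size_map_inj_poly ?rmorph0 //; last exact: val_inj.
  by apply: eq_bigr => j _; rewrite coef_map.
pose phi y := if pselect (exists p : {poly AT}, y = eval_at x p) is left h
              then map_poly pi (sval (cid h)) else 0.
have phiE p : phi (eval_at x p) = map_poly pi p.
  rewrite /phi; case: pselect => [h|[]]; last by exists p.
  case: (cid h) => q /= hq; apply/eqP; rewrite -subr_eq0 -rmorphB; apply/eqP/ker.
  by rewrite eval_atB -hq subrr.
exists D, (fun y => (phi y)`_0), phi.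
have cE (a : AT) : phi (val a) = (pi a)%:P by rewrite -(eval_atC x) phiE map_polyC.
split.
- split; first by have := cE 1; rewrite !rmorph1.
  split.
  + by move=> _ _ /gen_alg1P[p ->] /gen_alg1P[q ->]; rewrite -eval_atD !phiE rmorphD.
  + by move=> _ _ /gen_alg1P[p ->] /gen_alg1P[q ->]; rewrite -eval_atM !phiE rmorphM.
- by rewrite -[x in LHS]eval_atX phiE map_polyX.
- by move=> _ /subring_lift[a ->]; rewrite cE coefC /= -piP.
Qed.
End QuotientDomain.

(** * Determinants and algebraic elements *)

Section Det.
Variables (K : comPzRingType) (W J : set K).
Hypotheses (hW : subring W) (hJ : ideal_of W J).

Lemma subring_sign b : W ((-1) ^+ b).
Proof. by apply: subringX => //; apply: subgroupN; [apply: subring_subgroup | case: hW]. Qed.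

Lemma subring_det n (M : 'M[K]_n) : (forall i j, W (M i j)) -> W (\det M).
Proof.
move=> hM; apply: subgroup_sum => [|s _]; first exact: subring_subgroup.
have [_ [_ WM]] := hW; apply: WM; first exact: subring_sign.
exact: subring_prod.
Qed.

Lemma subring_adj n (M : 'M[K]_n) : (forall i j, W (M i j)) -> forall i j, W ((\adj M) i j).
Proof.
move=> hM i j; rewrite mxE /cofactor; have [_ [_ WM]] := hW.
apply: WM; first exact: subring_sign.
by apply: subring_det => k l; rewrite !mxE.
Qed.

Lemma det_congr n (M N : 'M[K]_n) : (forall i j, W (M i j)) -> (forall i j, W (N i j)) ->
  (forall i j, J (M i j - N i j)) -> J (\det M - \det N).
Proof.
move=> hM hN hMN; have [JW [gJ JM]] := hJ; have [W1 [WB WM]] := hW.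
rewrite /determinant -sumrB; apply: subgroup_sum => // s _.
rewrite -mulrBr; apply: (JM); first exact: subring_sign.
suff [//] : [/\ J (\prod_i M i (s i) - \prod_i N i (s i)),
             W (\prod_i M i (s i)) & W (\prod_i N i (s i))].
elim/big_rec2: _ => [|i x y _ [Jxy Wx Wy]].
  by rewrite subrr; case: gJ.
split; [|exact: WM|exact: WM].
have -> : M i (s i) * y - N i (s i) * x =
   M i (s i) * (y - x) + x * (M i (s i) - N i (s i)).
  by rewrite !mulrBr [x * M _ _]mulrC [x * N _ _]mulrC addrA subrK.
by apply: subgroupD => //; apply: JM.
Qed.
End Det.

Section Tower.
Variable S : comNzRingType.
Implicit Types (V I M W Q : set S).

Definition coefs_in V : set {poly S} := fun p => forall i, V p`_i.

Lemma coefs_in_subring V : subring V -> subring (coefs_in V).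
Proof.
move=> hV; have gV := subring_subgroup hV; have [V1 [VB VM]] := hV.
split; first by move=> i; rewrite coef1; case: eqP => _ //; case: gV.
split=> p q hp hq i; first by rewrite coefB; apply: VB.
by rewrite coefM; apply: subgroup_sum => // j _; apply: VM.
Qed.

Lemma coefs_in_ideal V I : ideal_of V I -> ideal_of (coefs_in V) (coefs_in I).
Proof.
move=> [IV [gI IM]]; split; first by move=> p hp i; apply: IV.
split; first split.
- by move=> i; rewrite coef0; case: gI.
- by move=> p q hp hq i; rewrite coefB; apply: gI.2.
- by move=> p q hp hq i; rewrite coefM; apply: subgroup_sum => // j _; apply: IM.
Qed.

Lemma char_poly_eval V I n (C : 'M[S]_n) z : subring V -> ideal_of V I ->
  (forall i j, I (C i j)) -> exists d : nat -> S, (forall i, I (d i)) /\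
  \det (z%:M - C) = z ^+ n + \sum_(i < n) d i * z ^+ i.
Proof.
move=> hV hI hC; have [IV [gI IM]] := hI; have gV := subring_subgroup hV.
have hX : coefs_in V 'X.
  by move=> i; rewrite coefX; case: eqP => _; [case: hV | case: gV].
have diag p : coefs_in V p -> forall b : bool, coefs_in V (p *+ b).
  by move=> hp [] i; rewrite ?mulr1n ?mulr0n //= coef0; case: gV.
have hIC i j : coefs_in I (C i j)%:P.
  by move=> k; rewrite coefC; case: eqP => _ //; case: gI.
have cong : coefs_in I (char_poly C - 'X^n).
  rewrite -det_scalar.
  apply: (det_congr (coefs_in_subring hV) (coefs_in_ideal hI)).
  - move=> i j k; rewrite !mxE coefB; apply: gV.2; first exact: diag.
    exact/IV/hIC.
  - by move=> i j; rewrite mxE; apply: diag.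
  - move=> i j k; rewrite !mxE [_ - _ *+ _]addrC addKr coefN; apply: subgroupN => //.
    exact: hIC.
exists (fun i => if (i < n)%N then (char_poly C)`_i else 0); split.
  move=> i; case: ifP => hi; last by case: gI.
  by have := cong i; rewrite coefB coefXn (ltn_eqF hi) subr0.
have -> : \det (z%:M - C) = (char_poly C).[z].
  rewrite -/(horner_eval z _) -det_map_mx; congr (\det _).
  apply/matrixP => i j; rewrite !mxE /= /horner_eval hornerD hornerN hornerC.
  by rewrite hornerMn hornerX.
have /monicP := char_poly_monic C; rewrite /lead_coef size_char_poly /= => lead.
rewrite horner_coef size_char_poly big_ord_recr /= lead mul1r addrC.
by congr (_ + _); apply: eq_bigr => i _; rewrite ltn_ord.
Qed.

Definition lin_comb I Q (e : seq S) : set S := fun t =>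
  exists c : nat -> S, (forall i, I (c i)) /\ Q (t - \sum_(i < size e) c i * e`_i).

Lemma lin_comb_subgroup I Q : subgroup I -> subgroup Q -> forall e, subgroup (lin_comb I Q e).
Proof.
move=> gI gQ e; split.
  exists (fun=> 0); split; first by case: gI.
  by rewrite big1 ?subr0 // => [|i _]; [case: gQ | rewrite mul0r].
move=> x y [c [hc Qx]] [d [hd Qy]]; exists (fun i => c i - d i); split.
  by move=> i; apply: gI.2.
have -> : \sum_(i < size e) (c i - d i) * e`_i =
    \sum_(i < size e) c i * e`_i - \sum_(i < size e) d i * e`_i.
  by rewrite -sumrB; apply: eq_bigr => i _; rewrite mulrBl.
have -> (a b : S) : x - y - (a - b) = (x - a) - (y - b).
  by rewrite !opprB addrACA [RHS]addrACA [- y - a]addrC.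
exact: gQ.2.
Qed.

(* Cayley-Hamilton modulo [Q]. *)
Lemma det_trick V I W Q (e : seq S) z :
  subring V -> ideal_of V I -> subring W -> included V W -> ideal_of W Q -> W z ->
  (forall y, y \in e -> lin_comb I Q e (z * y)) ->
  exists d : nat -> S, (forall i, I (d i)) /\
    forall w, lin_comb V Q e w ->
      Q ((z ^+ size e + \sum_(i < size e) d i * z ^+ i) * w).
Proof.
move=> hV hI hW VW hQ Wz he; set n := size e.
have [QW [gQ QM]] := hQ; have [IV _] := hI; have gW := subring_subgroup hW.
have /choice[c hc] : forall j : 'I_n, exists c : nat -> S, (forall i, I (c i)) /\
    Q (z * e`_j - \sum_(i < size e) c i * e`_i).
  by move=> j; apply: he; apply: mem_nth.
pose C := \matrix_(j < n, i < n) c j i.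
have hC i j : I (C i j) by rewrite mxE; case: (hc i).
have [d [hd dE]] := char_poly_eval z hV hI hC.
exists d; split=> // w [u [hu hw]]; rewrite -dE; set E := \det _.
have hM i j : W ((z%:M - C) i j).
  rewrite !mxE; apply: gW.2; last by apply/VW/IV; case: (hc i).
  by case: eqP => _; rewrite ?mulr1n ?mulr0n //; case: gW.
have WE : W E by apply: subring_det.
pose v := \col_(j < n) e`_j.
have hv j : Q (((z%:M - C) *m v) j 0).
  have -> : ((z%:M - C) *m v) j 0 = z * e`_j - \sum_(i < size e) c j i * e`_i.
    rewrite mulmxBl mul_scalar_mx !mxE; congr (_ - _).
    by apply: eq_bigr => i _; rewrite !mxE.
  by case: (hc j).
have hE (k : 'I_n) : Q (E * e`_k).
  have -> : E * e`_k = (\adj (z%:M - C) *m ((z%:M - C) *m v)) k 0.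
    by rewrite mulmxA mul_adj_mx mul_scalar_mx !mxE.
  rewrite mxE; apply: subgroup_sum => // j _; apply: QM => //; exact: subring_adj.
rewrite -[w](subrK (\sum_(i < size e) u i * e`_i)) mulrDr; apply: subgroupD => //.
  exact: QM.
rewrite mulr_sumr; apply: subgroup_sum => // i _; rewrite mulrCA.
by apply: QM => //; apply: VW.
Qed.

End Tower.

Section Algebraic.
Variables (S : comNzRingType) (V M W Q : set S).

(* Algebraicity over the localization of [V] at [M], modulo the ideal [Q] of [W], with
   denominators cleared.  [M = {1}], [Q = 0] is integrality over [V]; [M = V \ P],
   [Q = P W] is algebraicity in the fiber at [P]. *)
Definition algebraic : set S := fun x => exists (n : nat) (s : S) (r : nat -> S),
  M s /\ (forall i, V (r i)) /\ Q (s * x ^+ n + \sum_(i < n) r i * x ^+ i).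

(* [sat e] is the preimage in [W] of the span of [e] over the localization, modulo [Q],
   and [stab e] is the ring of multipliers of that span. *)
Definition sat (e : seq S) : set S := fun t =>
  W t /\ exists2 s, M s & lin_comb V Q e (s * t).

Definition stab (e : seq S) : set S := fun t =>
  W t /\ forall y, sat e y -> sat e (t * y).

Hypotheses (hV : subring V) (MV : included M V) (M1 : M 1)
  (MM : forall x y, M x -> M y -> M (x * y))
  (hW : subring W) (VW : included V W) (hQ : ideal_of W Q).

Let gV := subring_subgroup hV.
Let gW := subring_subgroup hW.
Let gQ := hQ.2.1.
Let QM := hQ.2.2.
Let VM := hV.2.2.
Let WM := hW.2.2.

Lemma lin_combQ e t : Q t -> lin_comb V Q e t.
Proof.
move=> Qt; exists (fun=> 0); split; first by move=> _; case: gV.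
by rewrite big1 ?subr0 // => i _; rewrite mul0r.
Qed.

Lemma lin_comb_mem e y : y \in e -> lin_comb V Q e y.
Proof.
move=> ye; have hi : (index y e < size e)%N by rewrite index_mem.
exists (fun i => (i == index y e)%:R); split.
  by move=> i; case: eqP => _; [case: hV | case: gV].
rewrite (bigD1 (Ordinal hi)) //= eqxx mul1r nth_index // big1 ?addr0 ?subrr.
  by case: gQ.
by move=> i; rewrite -val_eqE /= => /negbTE ->; rewrite mul0r.
Qed.

Lemma lin_combM e a t : V a -> lin_comb V Q e t -> lin_comb V Q e (a * t).
Proof.
move=> Va [c [hc Qt]]; exists (fun i => a * c i); split; first by move=> i; apply: VM.
under eq_bigr do rewrite -mulrA.
by rewrite -mulr_sumr -mulrBr; apply: QM => //; apply: VW.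
Qed.

Lemma satM e a t : V a -> sat e t -> sat e (a * t).
Proof.
move=> Va [Wt [s Ms hs]]; split; first by apply: WM => //; apply: VW.
by exists s => //; rewrite mulrCA; apply: lin_combM.
Qed.

Lemma sat_subgroup e : subgroup (sat e).
Proof.
have gL := lin_comb_subgroup gV gQ e.
split.
  by split; [case: gW | exists 1 => //; rewrite mulr0; case: gL].
move=> x y [Wx [s Ms hs]] [Wy [t Mt ht]]; split; first exact: gW.2.
exists (s * t); first exact: MM.
rewrite mulrBr; apply: gL.2.
  by rewrite mulrAC mulrC; apply: lin_combM => //; apply: MV.
by rewrite -mulrA; apply: lin_combM => //; apply: MV.
Qed.

Lemma satQ e t : Q t -> sat e t.
Proof.
by move=> Qt; split; [apply: hQ.1 | exists 1 => //; rewrite mul1r; apply: lin_combQ].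
Qed.

Lemma sat_mem e y : W y -> y \in e -> sat e y.
Proof. by move=> Wy ye; split=> //; exists 1 => //; rewrite mul1r; apply: lin_comb_mem. Qed.

Lemma sat_div e s t : M s -> W t -> sat e (s * t) -> sat e t.
Proof.
move=> Ms Wt [_ [s' Ms' h]]; split=> //; exists (s' * s); first exact: MM.
by rewrite -mulrA.
Qed.

Lemma sat_map e e' t : W t -> (forall y, y \in e -> sat e' (t * y)) ->
  forall y, sat e y -> sat e' (t * y).
Proof.
move=> Wt he y [Wy [s Ms [c [hc Qc]]]].
apply: (sat_div Ms); first exact: WM.
rewrite mulrCA -[s * y](subrK (\sum_(i < size e) c i * e`_i)) mulrDr.
have gS := sat_subgroup e'.
apply: subgroupD => //; first by apply: satQ; apply: QM.
rewrite mulr_sumr; apply: subgroup_sum => // i _; rewrite mulrCA.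
by apply: satM => //; apply: he; apply: mem_nth.
Qed.

Lemma stab_mem e t : W t -> (forall y, y \in e -> sat e (t * y)) -> stab e t.
Proof. by move=> Wt he; split=> //; apply: sat_map. Qed.

Lemma stab_subring e : subring (stab e).
Proof.
split; first by split; [case: hW | move=> y; rewrite mul1r].
split=> x y [Wx hx] [Wy hy].
  split; first exact: gW.2.
  move=> z hz; rewrite mulrBl; apply: (sat_subgroup e).2; [exact: hx | exact: hy].
by split; [apply: WM | move=> z hz; rewrite -mulrA; apply/hx/hy].
Qed.

Lemma stab_base e : included V (stab e).
Proof. by move=> a Va; split; [apply: VW | move=> y; apply: satM]. Qed.

Lemma stab_adjoin e x n s (r : nat -> S) : (forall y, y \in e -> W y) -> sat e 1 ->
  W x -> M s -> (forall i, (i < n)%N -> stab e (r i)) ->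
  Q (s * x ^+ n + \sum_(i < n) r i * x ^+ i) ->
  exists e', [/\ forall y, y \in e' -> W y, sat e' 1, stab e' x & included (stab e) (stab e')].
Proof.
move=> eW e1 Wx Ms hr hQx; pose e' := [seq x ^+ k * y | k <- iota 0 n, y <- e].
have WX k : W (x ^+ k) by apply: subringX.
have e'W y : y \in e' -> W y.
  by move=> /allpairsP[[k z] /= [_ /eW Wz ->]]; apply: WM.
have low k : (k < n)%N -> forall y, sat e y -> sat e' (x ^+ k * y).
  move=> kn; apply: sat_map => // y ye; apply: sat_mem.
    by apply: WM => //; apply: eW.
  by apply/allpairsP; exists (k, y); rewrite mem_iota.
have gS := sat_subgroup e'.
have top y : sat e y -> sat e' (x ^+ n * y).
  move=> hy; have Wy := hy.1; apply: (sat_div Ms); first exact: WM.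
  have -> : s * (x ^+ n * y) = y * (s * x ^+ n + \sum_(i < n) r i * x ^+ i)
      - \sum_(i < n) x ^+ i * (r i * y).
    rewrite mulrDr [y * \sum_(i < n) _]mulr_sumr.
    have -> : \sum_(i < n) y * (r i * x ^+ i) = \sum_(i < n) x ^+ i * (r i * y).
      by apply: eq_bigr => i _; rewrite mulrC mulrAC mulrC.
    by rewrite addrK mulrA mulrC.
  apply: gS.2; first by apply: satQ; apply: QM.
  apply: subgroup_sum => // i _; apply: low => //.
  by have [_] := hr i (ltn_ord i); apply.
have all_le k : (k <= n)%N -> forall y, sat e y -> sat e' (x ^+ k * y).
  by rewrite leq_eqVlt => /orP[/eqP ->|]; [apply: top | apply: low].
exists e'; split=> //.
- by have := all_le 0%N isT _ e1; rewrite expr0 mul1r.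
- apply: stab_mem => // _ /allpairsP[[k z] /= [kn ze ->]]; rewrite mulrA -exprS.
  apply: all_le; first by rewrite mem_iota in kn.
  by apply: sat_mem => //; apply: eW.
- move=> t [Wt ht]; apply: stab_mem => // _ /allpairsP[[k z] /= [kn ze ->]].
  rewrite mulrCA; apply: low; first by rewrite mem_iota in kn.
  by apply: ht; apply: sat_mem => //; apply: eW.
Qed.

Lemma algebraic_stab (xs : seq S) :
  (forall x, x \in xs -> W x /\ algebraic x) ->
  exists e, [/\ forall y, y \in e -> W y, sat e 1 & forall x, x \in xs -> stab e x].
Proof.
elim: xs => [|x xs IH] hxs.
  exists [:: 1]; split=> //; first by move=> y; rewrite inE => /eqP ->; case: hW.
  by apply: sat_mem; [case: hW | rewrite inE].
have [|e [eW e1 he]] := IH.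
  by move=> y yxs; apply: hxs; rewrite inE yxs orbT.
have [Wx [n [s [r [Ms [hr hQx]]]]]] := hxs x (mem_head _ _).
have [|e' [e'W e'1 hx he']] := stab_adjoin eW e1 Wx Ms _ hQx.
  by move=> i _; apply: stab_base.
exists e'; split=> // y; rewrite inE => /orP[/eqP ->//|/he]; exact: he'.
Qed.

Lemma stab_algebraic e x : (forall y, y \in e -> W y) -> sat e 1 -> stab e x -> algebraic x.
Proof.
move=> eW [_ [s0 Ms0 h0]] [Wx hx].
have [s Ms hs] : exists2 s, M s & forall y, y \in e -> lin_comb V Q e (s * x * y).
  have : forall y, y \in e -> sat e (x * y).
    by move=> y ye; apply: hx; apply: sat_mem => //; apply: eW.
  elim: {1 3}e => [|y l IH] hl; first by exists 1.
  have [|s Ms hs] := IH; first by move=> z zl; apply: hl; rewrite inE zl orbT.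
  have [_ [t Mt ht]] := hl y (mem_head _ _).
  exists (s * t); first exact: MM.
  move=> z; rewrite inE => /orP[/eqP ->|/hs h].
    by rewrite -!mulrA; apply: lin_combM => //; apply: MV.
  by rewrite [s * t]mulrC -!mulrA [s * _]mulrA; apply: lin_combM => //; apply: MV.
have VI := subring_ideal hV.
have Wsx : W (s * x) by apply: WM => //; apply/VW/MV.
have [d [hd hdet]] := det_trick hV VI hW VW hQ Wsx hs.
exists (size e), (s0 * s ^+ size e), (fun i => s0 * (d i * s ^+ i)).
have VX k : V (s ^+ k) by apply: subringX => //; apply: MV.
split; first by apply: MM => //; elim: (size e) => [//|k IH]; rewrite exprS; apply: MM.
split; first by move=> i; apply: VM; [apply: MV | apply: VM].
have := hdet _ h0; rewrite mulr1 mulrC mulrDr exprMn mulrA mulr_sumr.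
by under eq_bigr => i _ do rewrite exprMn mulrA mulrA -[_ * d i * _]mulrA.
Qed.

Lemma algebraic_gen (xs : seq S) x : (forall y, y \in xs -> W y /\ algebraic y) ->
  gen_alg V xs x -> algebraic x.
Proof.
move=> hxs hx; have [e [eW e1 he]] := algebraic_stab hxs.
apply: stab_algebraic e1 _ => //; apply: hx => //; [exact: stab_subring | exact: stab_base].
Qed.

Lemma algebraic_trans x n s (c : nat -> S) : W x -> M s ->
  (forall i, (i < n)%N -> W (c i) /\ algebraic (c i)) ->
  Q (s * x ^+ n + \sum_(i < n) c i * x ^+ i) -> algebraic x.
Proof.
move=> Wx Ms hc hQx.
have [|e [eW e1 he]] := @algebraic_stab (mkseq c n).
  by move=> _ /mapP[i + ->]; rewrite mem_iota => /hc.
have [|e' [e'W e'1 hx _]] := stab_adjoin eW e1 Wx Ms _ hQx.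
  by move=> i hi; apply: he; apply: map_f; rewrite mem_iota.
exact: stab_algebraic hx.
Qed.

End Algebraic.

Section Integral.
Variable S : comNzRingType.
Implicit Types (A B I P Q R T V : set S).

Local Notation is1 := (fun s : S => s = 1).
Local Notation is0 := (fun s : S => s = 0).

Lemma int_closureP V x : int_closure V setT x <-> algebraic V is1 is0 x.
Proof.
split=> [[_ [n [c [hc h]]]]|[n [s [r [-> [hr h]]]]]].
  by exists n, 1, c; rewrite mul1r.
by split=> //; exists n, r; rewrite mul1r in h.
Qed.

Lemma eq1_included V : subring V -> included is1 V.
Proof. by move=> [V1 _] x ->. Qed.

Lemma eq1M x y : is1 x -> is1 y -> is1 (x * y).
Proof. by move=> -> ->; rewrite mulr1. Qed.

Lemma int_closure_base V : subring V -> included V (int_closure V setT).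
Proof.
move=> hV x Vx; split=> //; exists 1%N, (fun=> - x); split.
  by move=> _; apply: subgroupN => //; apply: subring_subgroup.
by rewrite big_ord1 expr0 mulr1 expr1 subrr.
Qed.

Lemma int_closure_mono V V' : included V V' ->
  included (int_closure V setT) (int_closure V' setT).
Proof. by move=> VV' x [_ [n [c [hc h]]]]; split=> //; exists n, c; split=> // i; apply: VV'. Qed.

Lemma int_closure_subring V : subring V -> subring (int_closure V setT).
Proof.
move=> hV; split; first by apply: int_closure_base => //; case: hV.
have gen x y z : int_closure V setT x -> int_closure V setT y ->
    gen_alg V [:: x; y] z -> int_closure V setT z.
  move=> /int_closureP hx /int_closureP hy hz; apply/int_closureP.
  apply: (algebraic_gen hV (eq1_included hV) erefl eq1M (@subringT S) _
    (ideal_of0 (@subringT S))) hz => //.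
  by move=> w; rewrite !inE => /orP[] /eqP ->.
by split=> x y hx hy; apply: (gen x y _ hx hy);
  have [_ [GB GM]] := gen_alg_subring V [:: x; y]; [apply: GB|apply: GM];
  apply: gen_alg_mem; rewrite !inE eqxx ?orbT.
Qed.

Lemma int_closure_idem V : subring V ->
  included (int_closure (int_closure V setT) setT) (int_closure V setT).
Proof.
move=> hV x [_ [n [c [hc h]]]]; apply/int_closureP.
apply: (algebraic_trans hV (eq1_included hV) erefl eq1M (@subringT S) _
  (ideal_of0 (@subringT S)) (s := 1) (n := n) (c := c)) => //.
  by move=> i _; split=> //; apply/int_closureP.
by rewrite mul1r.
Qed.

Lemma integral_over_ideal V I y : subring V -> ideal_of V I ->
  ext_ideal I (int_closure V setT) y ->
  exists n (d : nat -> S), (forall i, I (d i)) /\ y ^+ n + \sum_(i < n) d i * y ^+ i = 0.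
Proof.
move=> hV hI [n [p [t [pt ->]]]]; set y' := \sum_(_ < _) _.
have [IV [gI IM]] := hI; have hT := @subringT S; have h0 := ideal_of0 hT.
have [//||e [_ [_ [s -> h1]] he]] :=
  @algebraic_stab _ V is1 _ is0 hV (eq1_included hV) erefl eq1M hT _ h0 (mkseq t n).
  by move=> _ /mapP[i _ ->]; split=> //; apply/int_closureP; case: (pt i).
have [//||d [hd hdet]] := @det_trick _ V I _ is0 e y' hV hI hT _ h0 Logic.I; last first.
  by exists (size e), d; split=> //; have := hdet _ h1; rewrite !mulr1.
move=> z ze; have gL := lin_comb_subgroup gI (@subgroup0 S) e.
rewrite mulr_suml; apply: subgroup_sum => // i _; rewrite -mulrA.
have [|_ hs] := he (t i); first by apply: map_f; rewrite mem_iota /=.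
have [|_ [s' -> [c [hc]]]] := hs z.
  by apply: (sat_mem hV erefl h0).
rewrite mul1r => /eqP; rewrite subr_eq0 => /eqP ->.
exists (fun j => c j * p i); split.
  by move=> j; apply: IM => //; case: (pt i).
apply/eqP; rewrite subr_eq0 mulr_sumr; apply/eqP.
by apply: eq_bigr => j _; rewrite mulrA [p i * _]mulrC.
Qed.

Lemma prime_complM V P : subring V -> prime_of V P ->
  forall x y, (V x /\ ~ P x) -> (V y /\ ~ P y) -> V (x * y) /\ ~ P (x * y).
Proof.
move=> hV [_ [_ [_ [_ [_ Pp]]]]] x y [Vx Px] [Vy Py].
by split; [case: hV => _ [_]; apply | move=> /(Pp _ _ Vx Vy)[]].
Qed.

Lemma prime_compl1 V P : subring V -> prime_of V P -> V 1 /\ ~ P 1.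
Proof. by move=> [V1 _] [_ [_ [_ [_ [P1 _]]]]]. Qed.

Lemma top_coef P Q x n (c : nat -> S) : subgroup Q ->
  (forall i k, P (c i) -> Q (c i * x ^+ k)) ->
  Q (\sum_(i < n) c i * x ^+ i) -> (exists2 i, (i < n)%N & ~ P (c i)) ->
  exists N, ~ P (c N) /\ Q (c N * x ^+ N + \sum_(i < N) c i * x ^+ i).
Proof.
move=> gQ PQ; elim: n => [|n IH]; first by move=> _ [].
rewrite big_ord_recr /= => hQ [i hi Pi].
case: (pselect (P (c n))) => [Pn|Pn]; last by exists n; split=> //; rewrite addrC.
apply: IH.
  by rewrite -[\sum_(_ < n) _](addrK (c n * x ^+ n)); apply: gQ.2 => //; apply: PQ.
exists i => //; move: hi; rewrite ltnS leq_eqVlt => /orP[/eqP ni|//].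
by case: Pi; rewrite ni.
Qed.

Lemma low_coef A P T Q t n (c : nat -> S) : subring T -> included A T -> prime_of T Q ->
  included P Q -> T t -> ~ Q t -> (forall i, A (c i)) ->
  Q (\sum_(i < n) c i * t ^+ i) -> (exists2 i, (i < n)%N & ~ P (c i)) ->
  exists r u, [/\ A r, ~ P r, T u & Q (r + t * u)].
Proof.
move=> hT AT hQ PQ Tt Qt; have [_ [Q0 [QB [_ [_ Qp]]]]] := hQ.
have [T1 [TB TM]] := hT; have gT := subring_subgroup hT.
elim: n c => [|n IH] c hc; first by move=> _ [].
have Tsum : T (\sum_(i < n) c i.+1 * t ^+ i).
  by apply: subgroup_sum => // i _; apply: (TM); [apply: AT | apply: subringX].
rewrite big_ord_recl expr0 mulr1.
have -> : \sum_(i < n) c (lift ord0 i) * t ^+ lift ord0 i =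
    t * \sum_(i < n) c i.+1 * t ^+ i.
  by rewrite mulr_sumr; apply: eq_bigr => i _; rewrite exprS mulrCA.
move=> hQs [i hi Pi]; case: (pselect (P (c 0%N))) => [P0|P0]; last first.
  by exists (c 0%N), (\sum_(i < n) c i.+1 * t ^+ i).
have : Q (t * \sum_(i < n) c i.+1 * t ^+ i).
  by rewrite -[t * _](addKr (c 0%N)) addrC; apply: (QB) => //; apply: PQ.
move=> /(Qp _ _ Tt Tsum)[//|/(IH _ (fun i => hc i.+1))]; apply.
by case: i hi Pi => [//|i] hi Pi; exists i.
Qed.

End Integral.

(** * Transcendental fibers *)

Section Morph.
Variables (S : comNzRingType) (V : set S) (C : comPzRingType) (f : S -> C).
Hypotheses (hV : subring V) (hf : rmorph_on V f).
Let gV := subring_subgroup hV.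

Lemma rmorph_on0 : f 0 = 0.
Proof.
have [_ [fD _]] := hf; have V0 : V 0 by case: gV.
by apply: (@addrI _ (f 0)); rewrite -fD // !addr0.
Qed.

Lemma rmorph_on_sum (T : Type) (r : seq T) (F : T -> S) : (forall i, V (F i)) ->
  f (\sum_(i <- r) F i) = \sum_(i <- r) f (F i).
Proof.
move=> hF; have [_ [fD _]] := hf.
elim: r => [|i r IH]; first by rewrite !big_nil rmorph_on0.
by rewrite !big_cons fD ?IH //; apply: subgroup_sum.
Qed.

Lemma rmorph_onX x n : V x -> f (x ^+ n) = f x ^+ n.
Proof.
move=> Vx; have [f1 [_ fM]] := hf; elim: n => [|n IH]; first by rewrite !expr0.
by rewrite !exprS fM ?IH //; apply: subringX.
Qed.

End Morph.

Section Key.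
Variable S : comNzRingType.
Implicit Types (A B I P Q R T V : set S).

Lemma transcendental_morphism A P x : subring A -> prime_of A P -> transcendental_mod A P x ->
  exists (D : idomainType) (phi : S -> {poly D}),
  [/\ rmorph_on (gen_alg A [:: x]) phi, phi x = 'X,
      forall a, A a -> exists2 d, phi a = d%:P & (d = 0 <-> P a),
      forall v, ext_ideal P (gen_alg A [:: x]) v -> phi v = 0
    & forall n s (r : nat -> S), A s -> ~ P s -> (forall i, A (r i)) ->
        phi (s * x ^+ n + \sum_(i < n) r i * x ^+ i) != 0].
Proof.
move=> hA hP tx.
have [D [ps [phi [hphi phix phia]]]] := transcendental_quotient hA hP tx.
exists D, phi; move: hphi (gen_alg_subring A [:: x]) (@gen_alg_base _ A [:: x])
  (@gen_alg_mem _ A _ _ (mem_head x [::])).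
move: (gen_alg A [:: x]) => V hphi hV AV Vx; have [_ [phiD phiM]] := hphi.
have gV := subring_subgroup hV; have PA := (prime_ideal hP).1.
split=> //.
- by move=> a /phia[-> ?]; exists (ps a).
- move=> _ [n [p [t [pt ->]]]]; rewrite (rmorph_on_sum hV hphi); last first.
    by move=> i; have [/PA/AV ? ?] := pt i; apply: hV.2.2.
  rewrite big1 // => i _; have [Pp Vt] := pt i; have Ap := PA _ Pp.
  have [ppi [_ ps0]] := phia _ Ap.
  by rewrite phiM ?ppi ?ps0 ?polyC0 ?mul0r //; apply: AV.
move=> n s r As Ps hr.
have Vterm a j : A a -> V (a * x ^+ j).
  by move=> Aa; apply: hV.2.2; [apply: AV | apply: subringX].
have phiT a j : A a -> phi (a * x ^+ j) = (ps a)%:P * 'X^j.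
  move=> Aa; rewrite phiM ?(rmorph_onX hV hphi) ?phix //.
  - by have [->] := phia a Aa.
  - exact: AV.
  - exact: subringX.
apply/eqP => /(congr1 (fun p : {poly D} => p`_n)).
rewrite phiD; [|exact: Vterm|by apply: subgroup_sum => // j _; apply: Vterm].
rewrite (rmorph_on_sum hV hphi) => [|j]; last exact: Vterm.
rewrite phiT // coefD coefCM coefXn eqxx mulr1 coef_sum big1 ?addr0 ?coef0.
  by have [_ [hps _]] := phia s As => /hps.
by move=> j _; rewrite phiT // coefCM coefXn gtn_eqF // mulr0.
Qed.

Lemma epi_not_transcendental A P x : subring A -> prime_of A P ->
  epimorphism A (gen_alg A [:: x]) -> ~ transcendental_mod A P x.
Proof.
move=> hA hP epi tx.
have [D [phi [hphi phix phia _ _]]] := transcendental_morphism hA hP tx.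
have [phi1 [phiD phiM]] := hphi.
have hg : rmorph_on (gen_alg A [:: x]) (fun y => (phi y).[0]%:P).
  split; first by rewrite phi1 hornerC.
  split=> u v hu hv; first by rewrite phiD // hornerD polyCD.
  by rewrite phiM // hornerM polyCM.
have /eqP : phi x = (phi x).[0]%:P.
  apply: (epi _ _ _ hphi hg); last by apply: gen_alg_mem; rewrite inE.
  by move=> a /phia[d -> _]; rewrite hornerC.
by rewrite phix hornerX polyC0 polyX_eq0.
Qed.

Lemma int_epi_not_transcendental R P x : subring R -> prime_of R P ->
  epimorphism (int_closure R setT) (gen_alg (int_closure R setT) [:: x]) ->
  ~ transcendental_mod R P x.
Proof.
move=> hR hP; set A := int_closure R setT => epi tx.
have [D [phi [hphi phix phia phiPV phi_lead]]] := transcendental_morphism hR hP tx.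
set V := gen_alg R [:: x] in hphi phiPV.
have hV : subring V by apply: gen_alg_subring.
have RV : included R V by apply: gen_alg_base.
have Vx : V x by apply: gen_alg_mem; rewrite inE.
clearbody V.
pose B := int_closure V setT.
have hA : subring A by apply: int_closure_subring.
have hB : subring B by apply: int_closure_subring.
have AB : included A B by apply: int_closure_mono.
have VB : included V B by apply: int_closure_base.
have RB : included R B by move=> r /RV/VB.
have gB := subring_subgroup hB; have [_ [_ BM]] := hB.
have hI := prime_ideal hP; have [PR [gP PM]] := hI.
have [phi1 [phiD phiM]] := hphi.
have hPV := ext_ideal_ideal hV RV hI.
pose M := fun v => V v /\ phi v != 0.
have [||||Q [hQ PQ QM]] :=
  @exists_prime_disjoint S B (ext_ideal P B) M hB (ext_ideal_ideal hB RB hI).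
- by move=> v [/VB].
- by split; [case: hV | rewrite phi1 oner_neq0].
- move=> u v [Vu hu] [Vv hv]; split; first by apply: hV.2.2.
  by rewrite phiM // mulf_neq0.
- move=> y hy [Vy /eqP phiy]; apply: phiy.
  have [|n [d [hd]]] := @integral_over_ideal S V (ext_ideal P V) y hV hPV.
    case: hy => n [p [t [pt ->]]]; exists n, p, t; split=> // i; have [Pp Bt] := pt i.
    by split=> //; rewrite -[p i]mulr1; apply: ext_idealM => //; case: hV.
  move=> /(congr1 phi); rewrite (rmorph_on0 hV hphi) phiD; last 2 first.
  + exact: subringX.
  + apply: subgroup_sum => [|i _]; first exact: subring_subgroup.
    by apply: hV.2.2; [apply: hPV.1 | apply: subringX].
  rewrite (rmorph_onX hV hphi) // (rmorph_on_sum hV hphi); last first.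
    by move=> i; apply: hV.2.2; [apply: hPV.1 | apply: subringX].
  rewrite big1 ?addr0.
    by move/eqP; rewrite expf_eq0 => /andP[_ /eqP].
  move=> i _; rewrite phiM ?(phiPV (d i)) ?mul0r //; [exact: hPV.1 | exact: subringX].
have PinQ : included P Q.
  by move=> p Pp; apply: PQ; rewrite -[p]mulr1; apply: ext_idealM => //; case: hB.
have QinP r : R r -> Q r -> P r.
  move=> Rr Qr; apply: contrapT => Pr; apply: QM Qr _; split; first exact: RV.
  by have [d -> hd] := phia r Rr; rewrite polyC_eq0; apply/eqP => /hd.
have [QB [gQ QBM]] := prime_ideal hQ; have [_ [_ [_ [_ [Q1 Qp]]]]] := hQ.
pose P' := fun a => A a /\ Q a.
have hP' : prime_of A P' by apply: prime_contraction hQ.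
have := epi_not_transcendental hA hP' epi; apply => n c hc hs i hi; apply: contrapT => ci.
have [|||N [cN hN]] := @top_coef S P' Q x n c gQ.
- by move=> j k [_ Qj]; rewrite mulrC; apply: QBM => //; apply: subringX => //; apply: VB.
- by rewrite hs; case: gQ.
- by exists i.
have [_ [m [d [hd hm]]]] := hc N.
pose d' j := if (j < m)%N then d j else 1.
have [||||||||r [u [Rr Pr Au hru]]] := @low_coef S R P A P' (c N) m.+1 d' hA.
- exact: int_closure_base.
- exact: hP'.
- by move=> p Pp; split; [apply: int_closure_base => //; apply: PR | apply: PinQ].
- exact: hc.
- exact: cN.
- by move=> j; rewrite /d'; case: ifP => _ //; case: hR.
- rewrite big_ord_recr /= /d' ltnn mul1r addrC.
  under eq_bigr => j _ do rewrite ltn_ord.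
  by rewrite hm; have [_ []] := hP'.
- by exists m => //; rewrite /d' ltnn; apply: (prime_compl1 hR hP).2.
have Bx := VB _ Vx.
have := @algebraic_trans S R (fun s => R s /\ ~ P s) B Q hR _ (prime_compl1 hR hP)
  (prime_complM hR hP) hB RB (prime_ideal hQ) x N r (fun i => - u * c i) Bx (conj Rr Pr).
case.
- by move=> ? [].
- move=> j _; have Auc : A (- u * c j).
    by apply: hA.2.2 => //; apply: subgroupN => //; apply: subring_subgroup.
  split; first exact: AB.
  move: Auc => /int_closureP[k [s [e [-> [he h]]]]]; exists k, 1, e.
  by split; [apply: prime_compl1 | split=> //; rewrite h; case: gQ].
- have -> : r * x ^+ N + \sum_(i < N) - u * c i * x ^+ i =
     x ^+ N * (r + c N * u) + - u * (c N * x ^+ N + \sum_(i < N) c i * x ^+ i).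
    rewrite [- u * (_ + _)]mulrDr mulr_sumr addrA; congr (_ + _); last first.
      by apply: eq_bigr => j _; rewrite mulrA.
    by rewrite mulrDr mulNr [_ * (c N * u)]mulrC [u * (_ * _)]mulrA [u * c N]mulrC addrK mulrC.
  apply: subgroupD => //; apply: QBM => //.
  + exact: subringX.
  + by case: hru.
  + by apply: subgroupN => //; apply: AB.
move=> k [s [e [[Rs Ps] [he]]]]; set y := _ + _ => hy.
have Vterm a j : R a -> V (a * x ^+ j).
  by move=> Ra; apply: hV.2.2; [apply: RV | apply: subringX].
apply: (QM _ hy); split; last exact: phi_lead.
apply: subgroupD; [exact: subring_subgroup | exact: Vterm |].
by apply: subgroup_sum => [|j _]; [apply: subring_subgroup | apply: Vterm].
Qed.

End Key.

(** * Finite and integral fibers *)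

Section Fibers.
Variable S : comNzRingType.
Implicit Types (A B I P Q R T V : set S).

Definition no_transcendental_mod R := forall x P, prime_of R P -> ~ transcendental_mod R P x.

Lemma not_transcendentalP R P x : ~ transcendental_mod R P x -> exists n (c : nat -> S),
  [/\ forall i, R (c i), \sum_(i < n) c i * x ^+ i = 0 & exists2 i, (i < n)%N & ~ P (c i)].
Proof.
move=> h; apply: contrapT => hno; apply: h => n c hc hs i hi.
by apply: contrapT => ci; apply: hno; exists n, c; split=> //; exists i.
Qed.

Section OneFiber.
Variables R T P : set S.
Hypotheses (hR : subring R) (hT : subring T) (RT : included R T) (hP : prime_of R P).
Local Notation M := (fun s => R s /\ ~ P s).
Local Notation PT := (ext_ideal P T).

Lemma fiber_ideal : ideal_of T PT.
Proof. exact: ext_ideal_ideal (prime_ideal hP). Qed.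

Lemma not_transcendental_algebraic x : T x -> ~ transcendental_mod R P x -> algebraic R M PT x.
Proof.
move=> Tx /not_transcendentalP[n [c [hc hs hi]]].
have [_ [gQ _]] := fiber_ideal.
have [|||N [cN hN]] := @top_coef S P PT x n c gQ.
- by move=> i k Pi; apply: ext_idealM => //; apply: subringX.
- by rewrite hs; case: gQ.
- by [].
by exists N, (c N), c.
Qed.

Lemma fiber_finite_dim_algebraic t : fiber_finite_dim R T P -> T t -> algebraic R M PT t.
Proof.
move=> [n [g [gT hg]]] Tt; pose e := mkseq g n.
have eT y : y \in e -> T y by move=> /mapP[i _ ->].
have all_sat u : T u -> sat R M T PT e u.
  move=> Tu; split=> //; have [s [r [Rs [Ps [hr hs]]]]] := hg u Tu.
  exists s => //; exists r; split=> //; rewrite size_mkseq.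
  rewrite (eq_bigr (fun i : 'I_n => r i * g i)) //.
  by move=> i _; rewrite nth_mkseq.
apply: (stab_algebraic hR _ (prime_compl1 hR hP) (prime_complM hR hP) hT RT fiber_ideal eT).
- by move=> ? [].
- by apply: all_sat; case: hT.
- by split=> // y [Ty _]; apply: all_sat; apply: hT.2.2.
Qed.

Lemma no_transcendental_fiber_finite_dim :
  no_transcendental_mod R -> finite_type R T -> fiber_finite_dim R T P.
Proof.
move=> hno [xs hxs].
have xsT x : x \in xs -> T x by move=> hx; apply/hxs; apply: gen_alg_mem.
have MR : included M R by move=> ? [].
have hPT := fiber_ideal.
have cM := prime_complM hR hP; have c1 := prime_compl1 hR hP.
have [|e [eT e1 he]] := @algebraic_stab S R M T PT hR MR c1 cM hT RT fiber_ideal xs.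
  by move=> x /xsT Tx; split=> //; apply: not_transcendental_algebraic => //; apply: hno.
exists (size e), (nth 0 e); split.
  move=> i; case: (ltnP i (size e)) => hi; first by apply: eT; apply: mem_nth.
  by rewrite nth_default //; case: (subring_subgroup hT).
move=> t /hxs ht.
have [_ /(_ 1 e1)] : stab R M T PT e t.
  apply: ht => //; [exact: stab_subring | exact: stab_base].
rewrite mulr1 => -[_ [s [Rs Ps] [r [hr hs]]]].
by exists s, r.
Qed.

Lemma fiber_incomparable Q Q' :
  (forall t, T t -> algebraic R M PT t) -> prime_of T Q -> prime_of T Q' ->
  included P Q -> (forall x, R x -> Q' x -> P x) -> included Q Q' -> included Q' Q.
Proof.
move=> alg hQ hQ' PQ Q'P QQ' t Q't; apply: contrapT => Qt.
have [Q'T [gQ' Q'M]] := prime_ideal hQ'; have Tt := Q'T t Q't.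
have [n [s [r [[Rs Ps] [hr hs]]]]] := alg t Tt.
pose c i := if (i < n)%N then r i else s.
have [|||||b [u [Rb Pb Tu hb]]] := @low_coef S R P T Q t n.+1 c hT RT hQ PQ.
- by [].
- by [].
- by move=> i; rewrite /c; case: ifP.
- rewrite big_ord_recr /= /c ltnn addrC.
  under eq_bigr => i _ do rewrite ltn_ord.
  by apply: (ext_ideal_sub PQ) hs; apply: prime_ideal.
- by exists n => //; rewrite /c ltnn.
apply/Pb/Q'P => //; rewrite -[b](addrK (t * u)); apply: gQ'.2; first exact: QQ'.
by rewrite mulrC; apply: Q'M.
Qed.

End OneFiber.

Lemma dependent_mod_prime R P n (a : nat -> nat -> S) : subring R -> prime_of R P ->
  (forall i j, R (a i j)) -> exists c : nat -> S,
  [/\ forall i, R (c i), exists2 i, (i <= n)%N & ~ P (c i)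
    & forall j, (j < n)%N -> P (\sum_(i < n.+1) c i * a i j)].
Proof.
move=> hR hP; have [PR [gP PM]] := prime_ideal hP.
have gR := subring_subgroup hR; have [R1 [RB RM]] := hR.
have P1 := (prime_compl1 hR hP).2.
elim: n a => [|n IH] a ha.
  by exists (fun=> 1); split=> //; exists 0%N.
have [hk|hk] := pselect (exists2 k, (k < n.+2)%N & ~ P (a k n)); last first.
  have {}hk i : (i < n.+2)%N -> P (a i n).
    by move=> hi; apply: contrapT => ?; apply: hk; exists i.
  have [c [hc [i hi ci] cP]] := IH a ha.
  exists (fun i => if (i <= n)%N then c i else 0); split.
  - by move=> j; case: ifP => _ //; case: gR.
  - by exists i; [apply: leq_trans hi _ | rewrite hi].
  move=> j; rewrite ltnS leq_eqVlt => /orP[/eqP ->|hj].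
    apply: subgroup_sum => // l _; apply: PM; last exact: hk.
    by case: ifP => _ //; case: gR.
  rewrite big_ord_recr /= ltnn mul0r addr0.
  by under eq_bigr => l _ do rewrite -ltnS ltn_ord; apply: cP.
have [k kn Pk] := hk.
pose f i := bump k i.
have [c [hc [i hi ci] cP]] := IH (fun i j => a k n * a (f i) j - a (f i) n * a k j)
  (fun i j => RB _ _ (RM _ _ (ha _ _) (ha _ _)) (RM _ _ (ha _ _) (ha _ _))).
pose c' j := if j == k then - \sum_(i < n.+1) c i * a (f i) n else c (unbump k j) * a k n.
have c'f j : c' (f j) = c j * a k n.
  by rewrite /c' eq_sym (negbTE (neq_bump _ _)) bumpK.
exists c'; split.
- move=> j; rewrite /c'; case: ifP => _; last exact: RM.
  by apply: subgroupN => //; apply: subgroup_sum => // l _; apply: RM.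
- exists (f i).
    by rewrite /f /bump; case: (k <= i)%N; rewrite ?add1n ?add0n ?ltnS // ltnW.
  rewrite c'f => /(hP.2.2.2.2.2 _ _ (hc i) (ha k n))[]//.
move=> j hj.
have -> : \sum_(i < n.+2) c' i * a i j =
   \sum_(i < n.+1) c i * (a k n * a (f i) j - a (f i) n * a k j).
  rewrite (bigD1_ord (Ordinal kn)) //= {1}/c' eqxx mulNr mulr_suml addrC -sumrB.
  apply: eq_bigr => l _; rewrite -/(f l) c'f mulrBr !mulrA; congr (_ - _).
move: hj; rewrite ltnS leq_eqVlt => /orP[/eqP ->|]; last exact: cP.
rewrite big1 => [|l _]; first exact: gP.1.
by rewrite [a k n * _]mulrC subrr mulr0.
Qed.

Lemma fiber_finite_dim_finite R T P : subring R -> subring T -> included R T ->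
  prime_of R P -> fiber_finite_dim R T P ->
  finite_set [set Q : set S | prime_of T Q /\ (forall x, R x -> (Q x <-> P x))].
Proof.
move=> hR hT RT hP hfin; apply: contrapT => hinf.
have alg t := fiber_finite_dim_algebraic hR hT RT hP hfin (t := t).
have [n [g [gT hg]]] := hfin.
have [B BQ] := infinite_set_fset n.+1 hinf.
move=> hB; pose Qs i := nth set0 B i.
have hQs i : (i <= n)%N -> prime_of T (Qs i) /\ (forall x, R x -> (Qs i x <-> P x)).
  move=> hi; have : Qs i \in B by apply: mem_nth; apply: leq_ltn_trans hB.
  by move=> /BQ.
have PR := (prime_ideal hP).1.
have PQ i : (i <= n)%N -> included P (Qs i).
  by move=> hi x Px; apply/(hQs i hi).2 => //; apply: PR.
have sep i j : exists t, [/\ T t, (i <= n)%N -> (j <= n)%N -> i != j -> Qs j t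
    & (i <= n)%N -> (j <= n)%N -> i != j -> ~ Qs i t].
  have [hi|hi] := boolP (i <= n)%N; last by exists 0; split=> //; case: (subring_subgroup hT).
  have [hj|hj] := boolP (j <= n)%N; last by exists 0; split=> //; case: (subring_subgroup hT).
  have [ij|ij] := eqVneq i j; first by exists 0; split=> //; case: (subring_subgroup hT).
  have [hQi hQiP] := hQs i hi; have [hQj hQjP] := hQs j hj.
  apply: contrapT => hno.
  have sub : included (Qs j) (Qs i).
    move=> t Qt; apply: contrapT => Qt'; apply: hno; exists t; split=> //.
    by apply: (prime_ideal hQj).1.
  have sub' : included (Qs i) (Qs j).
    apply: (fiber_incomparable hT RT alg hQj hQi) => //; first exact: PQ.
    by move=> x Rx /hQiP; apply.
  have : Qs i == Qs j by apply/eqP/seteqP; split.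
  rewrite nth_uniq ?(negbTE ij) //; [exact: leq_ltn_trans hB|exact: leq_ltn_trans hB|].
  exact: fset_uniq.
have /choice[t ht] : forall i, exists t : nat -> S, forall j, [/\ T (t j),
    (i <= n)%N -> (j <= n)%N -> i != j -> Qs j (t j)
    & (i <= n)%N -> (j <= n)%N -> i != j -> ~ Qs i (t j)].
  by move=> i; have /choice[ti hti] := sep i; exists ti.
pose e i := \prod_(j < n.+1 | (j : nat) != i) t i j.
have eT i : T (e i) by apply: subring_prod => // j _; case: (ht i j).
have eQ i j : (i <= n)%N -> (j <= n)%N -> i != j -> Qs j (e i).
  move=> hi hj ij; rewrite /e (bigD1 (Ordinal (hj : j < n.+1)%N)) /=; last by rewrite eq_sym.
  rewrite mulrC; apply: (prime_ideal (hQs j hj).1).2.2.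
    by apply: subring_prod => // l _; case: (ht i l).
  by case: (ht i j) => _ h _; apply: h.
have eQn i : (i <= n)%N -> ~ Qs i (e i).
  move=> hi; have hQi := (hQs i hi).1.
  suff [] : T (e i) /\ ~ Qs i (e i) by [].
  rewrite /e; elim/big_ind: _.
  - exact: prime_compl1.
  - exact: prime_complM.
  - move=> j ji; have [? _ h] := ht i j; split=> //.
    by apply: h => //; [rewrite -ltnS | rewrite eq_sym].
have /choice[s hs] : forall i, exists s, exists r : nat -> S,
    R s /\ ~ P s /\ (forall j, R (r j)) /\
    ext_ideal P T (s * e i - \sum_(j < n) r j * g j).
  by move=> i; apply: hg.
have /choice[r hr] := hs.
have [|c [hc [k hk ck] hcP]] := @dependent_mod_prime R P n r hR hP.
  by move=> i j; have [_ [_ []]] := hr i.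
apply: ck.
have hPT := fiber_ideal hT RT hP; have [_ [gPT PTM]] := hPT.
have hQk := (hQs k hk).1; have [QT [gQ QM]] := prime_ideal hQk.
have in_PT : ext_ideal P T (\sum_(i < n.+1) c i * (s i * e i)).
  have -> : \sum_(i < n.+1) c i * (s i * e i) =
      \sum_(i < n.+1) c i * (s i * e i - \sum_(j < n) r i j * g j) +
      \sum_(j < n) (\sum_(i < n.+1) c i * r i j) * g j.
    have -> : \sum_(j < n) (\sum_(i < n.+1) c i * r i j) * g j =
        \sum_(i < n.+1) c i * \sum_(j < n) r i j * g j.
      under eq_bigr => j _ do rewrite mulr_suml.
      rewrite exchange_big /=; apply: eq_bigr => i _; rewrite mulr_sumr.
      by apply: eq_bigr => j _; rewrite mulrA.
    by rewrite -big_split /=; apply: eq_bigr => i _; rewrite -mulrDr subrK.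
  apply: subgroupD => //; apply: subgroup_sum => // i _.
    by apply: PTM; [apply: RT | have [_ [_ [_]]] := hr i].
  by apply: ext_idealM => //; apply: hcP.
have : Qs k (\sum_(i < n.+1) c i * (s i * e i)).
  exact: (ext_ideal_sub (PQ k hk) (prime_ideal hQk)).
rewrite (bigD1 (Ordinal (hk : k < n.+1)%N)) //= => hsum.
have hck : Qs k (c k * (s k * e k)).
  rewrite -[c k * _](addrK (\sum_(i < n.+1 | i != Ordinal (hk : k < n.+1)%N) c i * (s i * e i))).
  apply: gQ.2 => //; apply: subgroup_sum => // i ik.
  have Rs : R (s i) by case: (hr i).
  rewrite mulrA; apply: QM; first by apply: hT.2.2; apply: RT.
  by apply: eQ => //; rewrite -ltnS.
have [Rs [Ps _]] := hr k.
have Tsk := RT _ Rs.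
have := hQk.2.2.2.2.2; move=> Qp.
have := Qp _ _ (RT _ (hc k)) (hT.2.2 _ _ Tsk (eT k)) hck.
case=> [/(hQs k hk).2|]; first by apply.
by case/(Qp _ _ Tsk (eT k)) => [/(hQs k hk).2 h|/eQn//]; case: Ps; apply: h.
Qed.

(* Euclid's argument: if the fiber of [R[x]] at [P] is a polynomial ring, a prime
   containing [1 + x * h], with [h] in all the nonzero primes of a finite list, is new. *)
Lemma finite_fibers_not_transcendental R P x : subring R -> prime_of R P ->
  finite_fibers R (gen_alg R [:: x]) -> ~ transcendental_mod R P x.
Proof.
move=> hR hP hfin tx.
have [D [phi [hphi phix phia phiPV _]]] := transcendental_morphism hR hP tx.
have := hfin P hP; move: hphi (gen_alg_subring R [:: x]) (@gen_alg_base _ R [:: x])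
  (@gen_alg_mem _ R _ _ (mem_head x [::])) phiPV.
move: (gen_alg R [:: x]) => V hphi hV RV Vx phiPV /finite_seqP[F hF].
have [phi1 [phiD phiM]] := hphi; have gV := subring_subgroup hV.
have [V1 [_ VM]] := hV.
have phi0 := rmorph_on0 hV hphi.
have /choice[h hh] : forall Q : set S, exists h, [/\ V h, phi h != 0
    & prime_of V Q -> (exists2 q, Q q & phi q != 0) -> Q h].
  move=> Q; have [[hQ [q Qq q0]]|hno] := pselect (prime_of V Q /\ exists2 q, Q q & phi q != 0).
    by exists q; split=> //; apply: (prime_ideal hQ).1.
  by exists 1; rewrite phi1 oner_neq0; split=> // hQ hq; case: hno.
pose H := \prod_(Q <- F) h Q.
have [VH phiH] : V H /\ phi H != 0.
  rewrite /H; elim/big_ind: _.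
  - by rewrite phi1 oner_neq0.
  - by move=> a b [Va a0] [Vb b0]; split; [apply: VM | rewrite phiM // mulf_neq0].
  - by move=> Q _; have [] := hh Q.
pose w := 1 + x * H.
have VxH : V (x * H) by apply: VM.
have Vw : V w by apply: subgroupD.
have sw : (1 < size (phi w))%N.
  rewrite /w phiD // phi1 phiM // phix addrC mulrC size_polyDl.
    by rewrite size_mulX // ltnS size_poly_gt0.
  by rewrite size_poly1 size_mulX // ltnS size_poly_gt0.
have w0 : phi w != 0 by rewrite -size_poly_gt0 ltnW.
pose I := fun u => V u /\ exists2 v, V v & phi u = phi w * phi v.
pose M := fun u => V u /\ size (phi u) = 1%N.
have phiB u v : V u -> V v -> phi (u - v) = phi u - phi v.
  move=> Vu Vv; apply/eqP; rewrite eq_sym subr_eq -phiD ?subrK //; exact: gV.2.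
have hI : ideal_of V I.
  split; first by move=> u [].
  split; first split.
  - by split; [case: gV | exists 0; rewrite ?phi0 ?mulr0 //; case: gV].
  - move=> u v [Vu [u' Vu' hu]] [Vv [v' Vv' hv]]; split; first exact: gV.2.
    by exists (u' - v'); [apply: gV.2 | rewrite !phiB // mulrBr hu hv].
  - move=> a u Va [Vu [u' Vu' hu]]; split; first exact: VM.
    by exists (a * u'); [apply: VM | rewrite !phiM // hu mulrCA].
have [||||Q [hQ IQ QM]] := @exists_prime_disjoint S V I M hV hI.
- by move=> u [].
- by split=> //; rewrite phi1 size_poly1.
- move=> u v [Vu su] [Vv sv]; split; first exact: VM.
  by rewrite phiM // size_mul -?size_poly_gt0 ?su ?sv.
- move=> u [Vu [v Vv hu]] [_]; rewrite hu.
  have [->|v0] := eqVneq (phi v) 0; first by rewrite mulr0 size_poly0.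
  rewrite size_mul //; case: (size (phi w)) sw => [|[|m]]// _.
  move: v0; rewrite -size_poly_gt0; case: (size (phi v)) => // k _.
  by rewrite addnS addSn /= addSn.
have Qw : Q w by apply: IQ; split=> //; exists 1 => //; rewrite phi1 mulr1.
have QF : Q \in F.
  suff : [set` F] Q by [].
  rewrite -hF; split=> // r Rr; have [d phir hd] := phia r Rr; split=> [Qr|Pr].
    apply: contrapT => Pr; apply: (QM _ Qr); split; first exact: RV.
    by rewrite phir size_polyC; case: eqP => // /hd.
  apply: IQ; split; first exact: RV.
  exists 0; first by case: gV.
  by rewrite phi0 mulr0 phir (hd.2 Pr) polyC0.
have [_ [gQ QVM]] := prime_ideal hQ; have [_ [_ [_ [_ [Q1 _]]]]] := hQ.
apply: Q1; rewrite -[1](addrK (x * H)); apply: gQ.2 => //.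
apply: (QVM) => //.
rewrite /H (big_rem Q) //= mulrC; apply: QVM.
  by apply: subring_prod => // Q' _; have [] := hh Q'.
by have [_ _] := hh Q; apply=> //; exists w.
Qed.

Lemma fiber_integral_not_transcendental R P x : subring R -> prime_of R P ->
  fiber_integral R (gen_alg R [:: x]) P -> ~ transcendental_mod R P x.
Proof.
move=> hR hP hint tx.
have [D [phi [_ _ _ phiPV phi_lead]]] := transcendental_morphism hR hP tx.
have [|n [s [r [Rs [Ps [hr /phiPV h]]]]]] := hint x.
  by apply: gen_alg_mem; apply: mem_head.
by have := phi_lead n s r Rs Ps hr; rewrite h eqxx.
Qed.

End Fibers.

(** * Flat epimorphisms from denominators *)

Section PruferCriterion.
Variable S : comNzRingType.
Implicit Types (A R U : set S).

(* [(A : x) + (A : x) x], where [(A : x)] is the ideal of denominators of [x]. *)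
Definition denom_span A x : set S := fun a => exists p q,
  [/\ A p /\ A (p * x), A q /\ A (q * x) & a = p + q * x].

Lemma denom_span_subgroup A x : subring A -> subgroup (denom_span A x).
Proof.
move=> hA; have gA := subring_subgroup hA; split.
  by exists 0, 0; rewrite !mul0r addr0; split=> //; split; case: gA.
move=> _ _ [p [q [[Ap Apx] [Aq Aqx] ->]]] [p' [q' [[Ap' Apx'] [Aq' Aqx'] ->]]].
exists (p - p'), (q - q'); rewrite !mulrBl.
by split; [split; apply: gA.2 | split; apply: gA.2 | rewrite opprD addrACA].
Qed.

Lemma denom_spanM A x a y : subring A -> A a -> denom_span A x y -> denom_span A x (a * y).
Proof.
move=> hA Aa [p [q [[Ap Apx] [Aq Aqx] ->]]]; have AM := hA.2.2.
exists (a * p), (a * q); rewrite -!mulrA mulrDr.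
by split=> //; split; apply: AM.
Qed.

Lemma lead_coef_mul_integral A x n (c : nat -> S) : subring A -> (forall i, A (c i)) ->
  \sum_(i < n.+1) c i * x ^+ i = 0 -> int_closure A setT (c n * x).
Proof.
move=> hA hc; case: n => [|n].
  rewrite big_ord1 expr0 mulr1 => ->; rewrite mul0r; apply: int_closure_base => //.
  by case: (subring_subgroup hA).
move=> hs; split=> //; exists n.+1, (fun i => c i * c n.+1 ^+ (n - i)); split.
  by move=> i; apply: hA.2.2 => //; apply: subringX.
have := congr1 ( *%R (c n.+1 ^+ n)) hs.
rewrite mulr0 mulr_sumr big_ord_recr /= => hs'; rewrite -[RHS]hs' [LHS]addrC.
congr (_ + _); last first.
  by rewrite exprMn [c n.+1 ^+ n.+1]exprSr -!mulrA.
apply: eq_bigr => i _; rewrite exprMn -mulrA [_ ^+ (n - i) * _]mulrA -exprD subnK.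
  by rewrite mulrCA.
by rewrite -ltnS.
Qed.

(* Horner's scheme: the partial values [c_n x^k + ... + c_(n-k)] stay in [A]. *)
Lemma coef_in_denom_span A x n (c : nat -> S) : subring A ->
  included (int_closure A setT) A -> (forall i, A (c i)) ->
  \sum_(i < n) c i * x ^+ i = 0 -> forall i, (i < n)%N -> denom_span A x (c i).
Proof.
move=> hA Acl; have gA := subring_subgroup hA; have gI := denom_span_subgroup x hA.
have lead a : A a -> A (a * x) -> denom_span A x a /\ denom_span A x (a * x).
  move=> Aa Aax; split.
    by exists a, 0; rewrite !mul0r addr0; split=> //; split; case: gA.
  by exists 0, a; rewrite !mul0r add0r; split=> //; split; case: gA.
elim: n c => [//|n IH] c hc hs.
have Ax := Acl _ (lead_coef_mul_integral hA hc hs).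
have [l1 l2] := lead _ (hc n) Ax.
case: n IH hs Ax l1 l2 => [|n] IH hs Ax l1 l2 i; first by case: i.
rewrite ltnS leq_eqVlt => /orP[/eqP ->//|hi].
pose c' j := if j == n then c n + c n.+1 * x else c j.
have h' : denom_span A x (c' i).
  apply: IH => //.
    by move=> j; rewrite /c'; case: eqP => _ //; apply: subgroupD.
  rewrite -[RHS]hs !big_ord_recr /= /c' eqxx mulrDl -mulrA -exprS addrA.
  by congr (_ + _ + _); apply: eq_bigr => j _; rewrite (ltn_eqF (ltn_ord j)).
have [ni|ni] := eqVneq i n; last by move: h'; rewrite /c' (negbTE ni).
move: h'; rewrite /c' ni eqxx => h'.
by rewrite -[c n](addrK (c n.+1 * x)); apply: gI.2.
Qed.

Lemma no_transcendental_denom_span1 R x : subring R -> no_transcendental_mod R ->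
  denom_span (int_closure R setT) x 1.
Proof.
move=> hR hno; set A := int_closure R setT.
have hA : subring A by apply: int_closure_subring.
have RA : included R A by apply: int_closure_base.
have gI := denom_span_subgroup x hA.
apply: contrapT => h1.
have [||P hP IP] := @exists_prime_above S R (fun a => R a /\ denom_span A x a) hR.
- split; first by move=> ? [].
  split; first split.
  + by split; [case: (subring_subgroup hR) | case: gI].
  + by move=> a b [Ra ha] [Rb hb]; split; [apply: (subring_subgroup hR).2 | apply: gI.2].
  + by move=> a b Ra [Rb hb]; split; [apply: hR.2.2 | apply: denom_spanM => //; apply: RA].
- by case.
have [n [c [hc hs [i hi ci]]]] := not_transcendentalP (hno x P hP).
apply: ci; apply: IP; split=> //.
by apply: (coef_in_denom_span hA (@int_closure_idem S R hR) _ hs) => // j; apply: RA.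
Qed.

Lemma common_denominators A U (xs : seq S) : subring A -> subring U -> included A U ->
  (forall x, denom_span A x 1) -> (forall x, x \in xs -> U x) ->
  exists l : seq (S * S), \sum_(z <- l) z.1 * z.2 = 1 /\
    forall z, z \in l -> [/\ A z.1, U z.2 & forall x, x \in xs -> A (z.1 * x)].
Proof.
move=> hA hU AU h1; have AM := hA.2.2.
elim: xs => [|x xs IH] hxs.
  exists [:: (1, 1)]; rewrite big_seq1 mulr1; split=> // z; rewrite inE => /eqP -> /=.
  by split=> //; [case: hA | case: hU].
have [|l [l1 hl]] := IH; first by move=> y yxs; apply: hxs; rewrite inE yxs orbT.
have [p [q [[Ap Apx] [Aq Aqx] pq]]] := h1 x.
exists ([seq (z.1 * p, z.2) | z <- l] ++ [seq (z.1 * q, z.2 * x) | z <- l]); split.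
  rewrite big_cat !big_map /= -big_split /= -[RHS]l1; apply: eq_bigr => z _.
  rewrite -[RHS]mulr1 pq mulrDr mulrAC; congr (_ + _).
  by rewrite mulrACA.
have step z a : A a -> A (a * x) -> [/\ A z.1, U z.2 & forall x, x \in xs -> A (z.1 * x)] ->
    A (z.1 * a) /\ forall y, y \in x :: xs -> A (z.1 * a * y).
  move=> Aa Aax [Az _ hz]; split; first exact: AM.
  move=> y; rewrite inE => /orP[/eqP ->|/hz h]; first by rewrite -mulrA; apply: AM.
  by rewrite mulrAC; apply: AM.
move=> z; rewrite mem_cat => /orP[] /mapP[w /hl hw ->] /=; have [Aw Uw _] := hw.
  by have [] := step w p Ap Apx hw.
have [] := step w q Aq Aqx hw; split=> //; apply: hU.2.2 => //.
by apply: hxs; apply: mem_head.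
Qed.

Lemma denom_span_Prufer A : subring A -> (forall x, denom_span A x 1) -> Prufer A setT.
Proof.
move=> hA h1 U [hU [AU _]]; have gA := subring_subgroup hA.
split.
  move=> n a x Aa Ux hs.
  have [|l [l1 hl]] := @common_denominators A U (mkseq x n) hA hU AU h1.
    by move=> _ /mapP[i _ ->].
  pose z j := nth (0, 0) l j.
  have hz j : [/\ A (z j).1, U (z j).2 & forall i, (i < n)%N -> A ((z j).1 * x i)].
    case: (ltnP j (size l)) => hj.
      have [? ? h] := hl _ (mem_nth (0, 0) hj); split=> // i hi.
      by apply: h; apply: map_f; rewrite mem_iota.
    rewrite /z nth_default //=; split; [by case: gA| by case: (subring_subgroup hU)|].
    by move=> i _; rewrite mul0r; case: gA.
  exists (size l), (fun i j => if (i < n)%N then (z j).1 * x i else 0), (fun j => (z j).2).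
  split; first by move=> i j; case: ifP => hi; [case: (hz j) => _ _; apply | case: gA].
  split; first by move=> j; case: (hz j).
  split.
    move=> i hi; rewrite hi -[LHS]mul1r -l1 (big_nth (0, 0)) big_mkord mulr_suml.
    by apply: eq_bigr => j _; rewrite mulrAC.
  move=> j hj; transitivity ((z j).1 * \sum_(i < n) a i * x i); last by rewrite hs mulr0.
  by rewrite mulr_sumr; apply: eq_bigr => i _; rewrite ltn_ord mulrCA.
move=> C f g [f1 [fD fM]] [_ [_ gM]] fg x Ux.
have [p [q [[Ap Apx] [Aq Aqx] pq]]] := h1 x.
have kill a : A a -> A (a * x) -> f a * (f x - g x) = 0.
  move=> Aa Aax; rewrite mulrBr -fM ?(fg a) -?gM ?(fg (a * x)) ?subrr //; exact: AU.
apply/eqP; rewrite -subr_eq0 -[_ - _]mul1r -f1 pq fD; [|exact: AU|exact: AU].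
rewrite fM //; last exact: AU.
by rewrite mulrDl kill // add0r mulrAC kill // mul0r.
Qed.

Lemma no_transcendental_quasi_Prufer R :
  subring R -> no_transcendental_mod R -> quasi_Prufer R setT.
Proof.
move=> hR hno; apply: denom_span_Prufer; first exact: int_closure_subring.
by move=> x; apply: no_transcendental_denom_span1.
Qed.

Lemma quasi_Prufer_no_transcendental R :
  subring R -> quasi_Prufer R setT -> no_transcendental_mod R.
Proof.
move=> hR hqP x P hP; apply: int_epi_not_transcendental => //.
by apply: (hqP _ _).2; apply: gen_alg_interm.
Qed.

Lemma gen_alg_finite_type R xs : finite_type R (gen_alg R xs).
Proof. by exists xs. Qed.

Lemma quasi_Prufer_tfae R : subring R ->
  [<-> quasi_Prufer R setT;
       forall T, interm R setT T -> finite_type R T -> quasi_finite R T;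
       forall T, interm R setT T -> finite_type R T -> finite_fibers R T;
       forall T, interm R setT T ->
         forall P, prime_of R P -> fiber_integral R T P].
Proof.
move=> hR; tfae.
- move=> /(quasi_Prufer_no_transcendental hR) hno T [hT [RT _]] fT; split=> // P hP.
  exact: no_transcendental_fiber_finite_dim.
- move=> h T hTi fT P hP; have [hT [RT _]] := hTi.
  exact: fiber_finite_dim_finite ((h T hTi fT).2 P hP).
- move=> h T [hT [RT _]] P hP t Tt.
  have hnt : ~ transcendental_mod R P t.
    apply: finite_fibers_not_transcendental => //.
    by apply: h; [apply: gen_alg_interm | apply: gen_alg_finite_type].
  have [n [s [r [[Rs Ps] [hr hs]]]]] := not_transcendental_algebraic hT RT hP Tt hnt.
  by exists n, s, r.
- move=> h; apply: no_transcendental_quasi_Prufer => // x P hP.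
  by apply: fiber_integral_not_transcendental => //; apply: h => //; apply: gen_alg_interm.
Qed.

End PruferCriterion.

Lemma prime_of_neq0 (S : comPzRingType) (A P : set S) : prime_of A P -> (1 : S) <> 0.
Proof. by move=> [_ [P0 [_ [_ [P1 _]]]]] h; apply: P1; rewrite h. Qed.

(* R ⊆ S a ring extension: S the ambient ring, R a subring of S. *)
Theorem theorem6p2 (S : comPzRingType) (R : set S) (hR : subring R) :
  [<-> quasi_Prufer R setT;
       forall T, interm R setT T -> finite_type R T -> quasi_finite R T;
       forall T, interm R setT T -> finite_type R T -> finite_fibers R T;
       forall T, interm R setT T ->
         forall P, prime_of R P -> fiber_integral R T P].
Proof.
have [S0|/eqP S1] := eqVneq (1 : S) 0; last first.
  pose S' := HB.pack_for comNzRingType S (GRing.PzSemiRing_isNonZero.Build S (introN eqP S1)).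
  exact: (@quasi_Prufer_tfae S' R hR).
have x0 (x : S) : x = 0 by rewrite -[x]mul1r S0 mul0r.
tfae.
- by move=> _ T _ fT; split=> // P /prime_of_neq0.
- by move=> _ T _ _ P /prime_of_neq0.
- by move=> _ T _ P /prime_of_neq0.
move=> _ U [hU _]; split.
  move=> n a x _ _ _; exists 0%N, (fun _ _ => 0), (fun=> 0).
  have A0 : int_closure R setT 0.
    split=> //; exists 0%N, (fun=> 1); split; first by case: hR.
    by rewrite big_ord0 expr0 addr0.
  split=> //; split; first by move=> _; rewrite -S0; case: hU.
  by split=> // i _; rewrite big_ord0.
move=> C f g [f1 [fD _]] _ _ u Uu.
have C0 : (1 : C) = 0.
  rewrite -f1; apply: (@addrI _ (f 1)).
  by rewrite -fD ?addr0 ?[1 + 1]x0 -?S0 //; case: hU.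
by rewrite -[f u]mul1r -[g u]mul1r C0 !mul0r.
Qed.
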